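(* Let $K$ be a field, let $S=K[t_1,\ldots,t_s]$ with the standard grading, and let $I\subset S$ be a nonzero proper unmixed radical graded ideal. If all the associated primes of $I$ are generated by linear forms, then there is an integer $r_0\geq 1$ such that $$\delta_I(1)>\cdots>\delta_I(r_0)=\delta_I(d)=1\quad\text{for all } d\geq r_0.$$
   Context: $S=\bigoplus_{d\ge 0}S_d$ is the standard graded polynomial ring and $\mathbb{N}_+$ is the set of positive integers. For a proper graded ideal $J$ of $S$ with $k=\dim(S/J)$ (Krull dimension) and Hilbert function $H_J(d)=\dim_K(S_d/J_d)$, the degree (multiplicity) is $\deg(S/J)=(k-1)!\lim_{d\to\infty}H_J(d)/d^{k-1}$ if $k\geq 1$ and $\deg(S/J)=\dim_K(S/J)$ if $k=0$. An ideal is unmixed if all its associated primes have the same height. $(J\colon f)=\{h\in S: hf\in J\}$. For $d\geq 1$, let $\mathcal{F}_d=\{f\in S_d: f\notin I,\ (I\colon f)\neq I\}$. The minimum distance function $\delta_I\colon\mathbb{N}_+\to\mathbb{Z}$ of $I$ is $\delta_I(d)=\deg(S/I)-\max\{\deg(S/(I,f)): f\in\mathcal{F}_d\}$ if $\mathcal{F}_d\neq\emptyset$, and $\delta_I(d)=\deg(S/I)$ if $\mathcal{F}_d=\emptyset$. *)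

(* Defs.v *)
From HB Require Import structures.
From mathcomp Require Import all_boot all_order all_algebra.
From mathcomp Require Import boolp classical_sets.
From mathcomp Require mpoly filter topology normedtype sequences.

Set Implicit Arguments.
Unset Strict Implicit.
Unset Printing Implicit Defensive.

Import Order.TTheory GRing.Theory Num.Theory.
Local Open Scope classical_set_scope.
Local Open Scope ring_scope.

(* The largest element of A, and 0 if A is empty or unbounded. *)
Definition set_max (A : set nat) : nat := xget 0%N (A `&` ubound A).

(* idealr_closed includes 1 \notin I. *)
Definition is_proper_ideal (R : comNzRingType) (I : set R) : Prop :=
  idealr_closed [in I].

Definition is_prime_ideal (R : comNzRingType) (P : set R) : Prop :=
  is_proper_ideal P /\ prime_idealr_closed [in P].

Definition ideal_gen (R : comNzRingType) (A : set R) : set R :=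
  [set p | exists (n : nat) (a g : 'I_n -> R),
     (forall i, A (g i)) /\ p = \sum_(i < n) a i * g i].

Definition colon (R : comNzRingType) (I : set R) (f : R) : set R :=
  [set h | I (h * f)].

Definition radical (R : comNzRingType) (I : set R) : set R :=
  [set f | exists2 n, (0 < n)%N & I (f ^+ n)].

(* The annihilator of the class of g in R / I is (I : g). *)
Definition assoc_prime (R : comNzRingType) (I : set R) : set (set R) :=
  [set P | is_prime_ideal P /\ exists g, P = colon I g].

(* c 0, ..., c n is a strict chain of primes, of length n; the values of c
   beyond n are irrelevant. *)
Definition prime_chain (R : comNzRingType) (n : nat) (c : nat -> set R) : Prop :=
  (forall i, (i <= n)%N -> is_prime_ideal (c i)) /\
  (forall i, (i < n)%N -> c i `<` c i.+1).

Definition height (R : comNzRingType) (P : set R) : nat :=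
  set_max [set n | exists2 c, prime_chain n c & c n = P].

(* The Krull dimension of R / J: the primes of R / J correspond to the primes
   of R containing J. *)
Definition krull_dim_quot (R : comNzRingType) (J : set R) : nat :=
  set_max [set n | exists2 c, prime_chain n c & J `<=` c 0%N].

Definition unmixed (R : comNzRingType) (I : set R) : Prop :=
  forall P Q, assoc_prime I P -> assoc_prime I Q -> height P = height Q.

(* The dimension of U / W for subspaces W of U: the largest size of a family
   in U that is linearly independent modulo W. *)
Definition quot_dim (K : fieldType) (V : lmodType K) (U W : set V) : nat :=
  set_max [set n | exists2 b : 'I_n -> V, (forall i, U (b i)) &
     forall c : 'I_n -> K, W (\sum_(i < n) c i *: b i) -> forall i, c i = 0].

(* The ^o selects the topology of the absolute value, which rat itself lacks. *)
Section RatLimit.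
Import filter topology normedtype sequences.
Import numFieldNormedType.Exports.
Definition rat_cvg (u : nat -> rat) (l : rat) : Prop :=
  (u : nat -> rat^o) @ \oo --> (l : rat^o).
End RatLimit.

Import mpoly.

Definition homog_part (K : fieldType) (s d : nat) : set {mpoly K[s]} :=
  [set p | p \is d.-homog].

Definition graded (K : fieldType) (s : nat) (J : set {mpoly K[s]}) : Prop :=
  forall p, J p -> forall d, J (pihomog mdeg d p).

Definition hilbert_fun (K : fieldType) (s : nat) (J : set {mpoly K[s]})
    (d : nat) : nat :=
  quot_dim (@homog_part K s d) (@homog_part K s d `&` J).

(* The degree of S / J is a nonnegative integer n, so the limit n / (k - 1)!
   is rational and it is the same to take it in rat or in the reals. *)
Definition degree (K : fieldType) (s : nat) (J : set {mpoly K[s]}) : nat :=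
  let k := krull_dim_quot J in
  if k == 0%N then quot_dim setT J
  else xget 0%N [set n : nat | exists2 l : rat,
         rat_cvg (fun d => (hilbert_fun J d)%:R / d%:R ^+ k.-1) l &
         n%:R = (k.-1)`!%:R * l].

Definition zero_div_forms (K : fieldType) (s : nat) (I : set {mpoly K[s]})
    (d : nat) : set {mpoly K[s]} :=
  [set f | [/\ homog_part d f, ~ I f & colon I f <> I]].

Definition min_dist (K : fieldType) (s : nat) (I : set {mpoly K[s]})
    (d : nat) : int :=
  if zero_div_forms I d == set0 then (degree I)%:Z
  else (degree I)%:Z -
    (set_max [set degree (ideal_gen (I `|` [set f]))
             | f in zero_div_forms I d])%:Z.

(* Main.v *)
From HB Require Import structures.
Require Import Defs.
From mathcomp Require Import all_boot all_order all_algebra.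
From mathcomp Require Import boolp classical_sets.
From mathcomp Require filter topology normedtype sequences.
From mathcomp Require Import zify ring.
Import Order.TTheory GRing.Theory Num.Theory.
Local Open Scope classical_set_scope.
Local Open Scope ring_scope.

Set Implicit Arguments.
Unset Strict Implicit.
Unset Printing Implicit Defensive.

(** Geometrically, [I] is the ideal of a union of finitely many linear
    subspaces [V(P)], [P] ranging over the associated primes, all of one
    dimension [k].  If a form [f] outside [I] vanishes on at least one of these
    subspaces, then [V(I, f)] has dimension [k] and its components of dimension
    [k] are the [V(P)] with [f] in [P], each of multiplicity one; hence
    [degree (I, f)] counts the [P] that contain [f] ([degree_cap_genU1]).  So
    [min_dist I d] is the least value, over the forms [f] of degree [d] outside
    [I], of the weight of [f], the number of [P] that do not contain [f]
    ([min_dist_weight]).  If a form of least weight misses two primes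
    [P] and [Q], multiplying it by a linear form in [P] and not in [Q] lowers
    the weight by at least one and keeps it positive ([weight_drop]): the
    minimum distance decreases strictly while it exceeds one.  If it misses
    a single prime [P] among several, it can be multiplied by a linear form
    outside [P] without changing the weight ([weight_one]): the value one
    persists.  If [I] is prime, all values are one ([min_dist1]).

    The commutative algebra behind this is as follows.

    - Polynomial rings are Noetherian ([mpoly_noetherian]): along a strictly
      increasing sequence of ideals take new elements of least leading
      monomials; by Dickson's lemma one of these monomials divides a later one,
      and the later element can be reduced.  It follows that a radical ideal
      whose associated primes are incomparable has finitely many of them and is
      their intersection ([radical_is_cap]).

    - A chain of primes in [K[t_1, ..., t_s]] has length at most [s]
      ([prime_chain_bound]): elements [x_i] that witness the [n] strict
      inclusions have linearly independent monomials, and the dimension of the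
      span of those with exponents below [N] grows like [N ^ n], whereas
      polynomials of degree at most [c N] form a space of dimension
      [O(N ^ s)].  An ideal generated by linear forms is the kernel of a linear
      substitution, so it is prime, and a flag of linear forms puts it into a
      chain of length [s].  With the bound, this gives its height and the
      Krull dimension of its quotient ([height_lker], [krull_dim_linear]).

    - For [k >= 1], the Hilbert function of an intersection of [m] distinct
      linear primes of dimension [k] is [m d ^ (k-1) / (k-1)!] to leading order
      ([hilbert_cap_cvg]).  For [J = (I, f)], the exact sequence
      [0 -> S/(I : f)(-e) -> S/I -> S/J -> 0] ([hilbert_colon]) reduces the
      computation to [I] and to [(I : f)], which is the intersection of the
      primes that do not contain [f] ([colon_cap]). *)

(** * Limits of rational sequences *)

Section RationalLimits.
Import filter topology normedtype sequences.
Import numFieldNormedType.Exports.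
Implicit Types (u v w : nat -> rat) (l : rat).

Lemma rat_cvg_unique u l l' : rat_cvg u l -> rat_cvg u l' -> l = l'.
Proof. by move=> ul ul'; apply: (cvg_unique _ ul ul'); apply: norm_hausdorff. Qed.

Lemma rat_cvg_cst l : rat_cvg (fun=> l) l.
Proof. exact: cvg_cst. Qed.

Lemma rat_cvgD u v l l' :
  rat_cvg u l -> rat_cvg v l' -> rat_cvg (fun d => u d + v d) (l + l').
Proof. exact: cvgD. Qed.

Lemma rat_cvgM u v l l' :
  rat_cvg u l -> rat_cvg v l' -> rat_cvg (fun d => u d * v d) (l * l').
Proof. exact: cvgM. Qed.

Lemma rat_cvgB u v l l' :
  rat_cvg u l -> rat_cvg v l' -> rat_cvg (fun d => u d - v d) (l - l').
Proof. exact: cvgB. Qed.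

Lemma rat_cvg_shift k u l : rat_cvg (fun d => u (d + k)%N) l <-> rat_cvg u l.
Proof. by rewrite /rat_cvg cvg_shiftn. Qed.

Lemma rat_cvg_squeeze u v w l :
    (forall d, u d <= v d <= w d) -> rat_cvg u l -> rat_cvg w l -> rat_cvg v l.
Proof. by move=> uvw; apply: squeeze_cvgr; apply: nearW. Qed.

Lemma rat_cvg_inv k : rat_cvg (fun d => (d + k)%:R^-1) 0.
Proof.
apply/(rat_cvg_shift 1).
have : rat_cvg (@harmonic rat) 0 by exact: cvg_harmonic.
move/(proj2 (rat_cvg_shift k _ _)); congr rat_cvg.
by apply/funext => d /=; rewrite addnAC addn1.
Qed.

End RationalLimits.

(** This is the leading term of the Hilbert function of a polynomial ring in
    [n.+1] variables. The shift [k] in the denominator is for sequences read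
    from degree [k] on, after multiplication by a form of degree [k]. *)
Lemma rat_cvg_bin n k :
  rat_cvg (fun d => 'C(d + n, n)%:R / (d + k)%:R ^+ n) (n`!%:R^-1).
Proof.
elim: n => [|n IHn].
  have -> : (fun d => 'C(d + 0, 0)%:R / (d + k)%:R ^+ 0) = (fun=> 1 : rat).
    by apply/funext => d; rewrite bin0 expr0 divr1.
  by rewrite fact0 invr1; apply: rat_cvg_cst.
apply/(rat_cvg_shift 1).
have step : rat_cvg (fun d => 1 + (n.+1%:R - k%:R) * (d + 1 + k)%:R^-1) 1.
  rewrite -[X in rat_cvg _ X]addr0 -(mulr0 (n.+1%:R - k%:R)).
  apply: rat_cvgD; first exact: rat_cvg_cst.
  apply: rat_cvgM; first exact: rat_cvg_cst.
  exact: (proj2 (rat_cvg_shift 1 _ _) (rat_cvg_inv k)).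
have := rat_cvgM (rat_cvgM (proj2 (rat_cvg_shift 1 _ _) IHn) step)
  (@rat_cvg_cst (n.+1%:R^-1)).
rewrite mulr1 factS natrM invfM mulrC.
congr rat_cvg; apply/funext => d /=.
have dk : (d + 1 + k)%:R != 0 :> rat by rewrite pnatr_eq0 addn1.
have n1 : n.+1%:R != 0 :> rat by rewrite pnatr_eq0.
have -> : 1 + (n.+1%:R - k%:R) * (d + 1 + k)%:R^-1 =
    (d + 1 + n.+1)%:R / (d + 1 + k)%:R :> rat.
  by apply: (mulIf dk); rewrite mulrDl !mulfVK // mul1r !natrD; ring.
have -> : 'C(d + 1 + n.+1, n.+1)%:R =
    (d + 1 + n.+1)%:R * 'C(d + 1 + n, n)%:R / n.+1%:R :> rat.
  apply: (mulIf n1); rewrite mulfVK // -!natrM mulnC addnS.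
  by rewrite -mul_bin_diag.
rewrite exprS invfM; ring.
Qed.

Lemma rat_cvg_ratio e k : rat_cvg (fun d => (d%:R / (d + e)%:R) ^+ k) 1.
Proof.
have ratio1 : rat_cvg (fun d => d%:R / (d + e)%:R) 1.
  apply/(rat_cvg_shift 1).
  have := rat_cvgB (@rat_cvg_cst 1) (rat_cvgM (@rat_cvg_cst e%:R)
    (proj2 (rat_cvg_shift 1 _ _) (@rat_cvg_inv e))).
  rewrite mulr0 subr0; congr rat_cvg; apply/funext => d.
  have de : (d + 1 + e)%:R != 0 :> rat by rewrite pnatr_eq0 addn1.
  by apply: (mulIf de); rewrite mulrBl !mulfVK // mul1r [in LHS]natrD addrK.
elim: k => [|k IHk].
  have -> : (fun d => (d%:R / (d + e)%:R) ^+ 0) = (fun=> 1 : rat).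
    by apply/funext => d; rewrite expr0.
  exact: rat_cvg_cst.
have := rat_cvgM ratio1 IHk; rewrite mulr1; congr rat_cvg.
by apply/funext => d; rewrite exprS.
Qed.

(** Delaying a sequence of polynomial growth does not change its leading
    coefficient. *)
Lemma rat_cvg_delay u e k l : rat_cvg (fun d => u d / d%:R ^+ k) l ->
  rat_cvg (fun d => u d / (d + e)%:R ^+ k) l.
Proof.
move=> ul; (* Skips the index 0, at which both denominators may vanish. *)
apply/(rat_cvg_shift 1).
have := proj2 (rat_cvg_shift 1 _ _) (rat_cvgM ul (@rat_cvg_ratio e k)).
rewrite mulr1; congr rat_cvg; apply/funext => d.
have d1 : (d + 1)%:R ^+ k != 0 :> rat by rewrite expf_neq0 // pnatr_eq0 addn1.
by rewrite expr_div_n mulrA divfK.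
Qed.

From mathcomp Require Import mpoly.
Import Order.TTheory GRing.Theory Num.Theory.
Local Open Scope classical_set_scope.
Local Open Scope ring_scope.

(** * Ideals, associated primes and the Noetherian property *)

Section Ideals.
Variable R : comNzRingType.
Implicit Types (I J P Q : set R) (l : seq (set R)).

(** Unlike [is_proper_ideal], this allows the unit ideal, which occurs as a
    colon ideal and as the empty intersection. *)
Definition is_ideal I : Prop :=
  I 0 /\ forall a u v, I u -> I v -> I (a * u + v).

Lemma is_proper_idealP I : is_proper_ideal I <-> is_ideal I /\ ~ I 1.
Proof.
split=> [[I0 I1 Ilin]|[[I0 Ilin] I1]].
  split; last by move=> /mem_set; apply/negP.
  by split=> [|a u v Iu Iv]; apply/set_mem => //; apply: Ilin; apply/mem_set.
split; [exact/mem_set | by apply/negP => /set_mem |].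
by move=> a u v /set_mem Iu /set_mem Iv; apply/mem_set/Ilin.
Qed.

Lemma is_prime_idealP P :
  is_prime_ideal P <->
  [/\ is_ideal P, ~ P 1 & forall u v, P (u * v) -> P u \/ P v].
Proof.
split=> [[/is_proper_idealP[iP P1] Ppr]|[iP P1 Ppr]]; split=> //.
- by move=> u v /mem_set/Ppr/orP[] /set_mem; [left | right].
- exact/is_proper_idealP.
- by move=> u v /set_mem/Ppr[] /mem_set ->; rewrite ?orbT.
Qed.

Lemma ideal0 I : is_ideal I -> I 0. Proof. by case. Qed.

Lemma idealM I a u : is_ideal I -> I u -> I (a * u).
Proof. by move=> [I0 Ilin] Iu; rewrite -[a * u]addr0; apply: Ilin. Qed.

Lemma idealMr I a u : is_ideal I -> I u -> I (u * a).
Proof. by rewrite mulrC; apply: idealM. Qed.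

Lemma idealD I u v : is_ideal I -> I u -> I v -> I (u + v).
Proof. by move=> [I0 Ilin] Iu Iv; rewrite -[u]mul1r; apply: Ilin. Qed.

Lemma idealN I u : is_ideal I -> I u -> I (- u).
Proof. by rewrite -mulN1r; apply: idealM. Qed.

Lemma idealB I u v : is_ideal I -> I u -> I v -> I (u - v).
Proof. by move=> iI Iu Iv; apply: idealD => //; apply: idealN. Qed.

Lemma ideal_sum I (T : Type) (r : seq T) (Pr : pred T) (F : T -> R) :
  is_ideal I -> (forall i, Pr i -> I (F i)) -> I (\sum_(i <- r | Pr i) F i).
Proof.
by move=> iI IF; apply: big_ind => //; [exact: ideal0|move=> *; exact: idealD].
Qed.

Lemma idealI I J : is_ideal I -> is_ideal J -> is_ideal (I `&` J).
Proof.
move=> iI iJ; split; first by split; apply: ideal0.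
by move=> a u v [Iu Ju] [Iv Jv]; split; apply: idealD => //; apply: idealM.
Qed.

Lemma colon_ideal I f : is_ideal I -> is_ideal (colon I f).
Proof.
move=> iI; rewrite /colon; split=> /= [|a u v Iu Iv].
  by rewrite mul0r; apply: ideal0.
by rewrite mulrDl -mulrA; apply: idealD => //; apply: idealM.
Qed.

Lemma prime_ideal P : is_prime_ideal P -> is_ideal P.
Proof. by case/is_prime_idealP. Qed.

Lemma prime_proper P : is_prime_ideal P -> ~ P 1.
Proof. by case/is_prime_idealP. Qed.

Lemma primeM P u v : is_prime_ideal P -> P (u * v) -> P u \/ P v.
Proof. by case/is_prime_idealP => _ _; apply. Qed.

Lemma prime_exp P u n : is_prime_ideal P -> P (u ^+ n) -> P u.
Proof.
move=> pP; elim: n => [|n IHn]; first by move/(prime_proper pP).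
by rewrite exprS => /(primeM pP)[].
Qed.

Lemma ideal_gen_sub (A : set R) I : is_ideal I -> A `<=` I -> ideal_gen A `<=` I.
Proof.
move=> iI AI p [n [a [g [Ag ->]]]]; apply: ideal_sum => // i _.
by apply: idealM => //; apply: AI.
Qed.

Lemma sub_ideal_gen (A : set R) : A `<=` ideal_gen A.
Proof.
move=> p Ap; exists 1%N, (fun=> 1), (fun=> p); split=> //.
by rewrite big_ord1 mul1r.
Qed.

Lemma ideal_genU1 I f p : is_ideal I ->
  ideal_gen (I `|` [set f]) p <-> exists2 i, I i & exists a, p = i + a * f.
Proof.
move=> iI; split=> [|[i Ii [a ->]]]; last first.
  exists 2%N, (fun j => if j == 0 then 1 else a),
    (fun j => if j == 0 then i else f); split=> [j|].
    by case: ifP => _; [left|right].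
  by rewrite big_ord_recl big_ord1 /= mul1r.
suff: ideal_gen (I `|` [set f]) `<=`
    [set p | exists2 i, I i & exists a, p = i + a * f] by apply.
apply: ideal_gen_sub => [|g [Ig|->]] /=; last 2 first.
- by exists g => //; exists 0; rewrite mul0r addr0.
- by exists 0; [exact: ideal0|exists 1; rewrite add0r mul1r].
split; first by exists 0; [exact: ideal0|exists 0; rewrite mul0r addr0].
move=> a u v [i Ii [b ->]] [j Ij [c ->]].
exists (a * i + j); first by apply: idealD => //; apply: idealM.
by exists (a * b + c); rewrite mulrDr mulrDl mulrA addrACA.
Qed.

Lemma ideal_gen_ideal (A : set R) : is_ideal (ideal_gen A).
Proof.
split.
  by exists 0%N, (fun=> 0), (fun=> 0); split; [case|rewrite big_ord0].
move=> a u v [m [b [g [Ag ->]]]] [n [c [h [Ah ->]]]].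
exists (m + n)%N, (fun i => match split i with inl j => a * b j | inr j => c j end),
  (fun i => match split i with inl j => g j | inr j => h j end).
split=> [i|]; first by case: (split i).
rewrite big_split_ord /= mulr_sumr; congr (_ + _); apply: eq_bigr => i _.
  by rewrite (unsplitK (inl i)) mulrA.
by rewrite (unsplitK (inr i)).
Qed.

Definition cap l : set R := [set p | forall P, P \in l -> P p].

Lemma cap_cons P l : cap (P :: l) = P `&` cap l.
Proof.
apply/seteqP; split=> p.
  move=> lp; split; first by apply: lp; rewrite mem_head.
  by move=> Q Ql; apply: lp; rewrite inE Ql orbT.
by move=> [Pp lp] Q; rewrite inE => /predU1P[->//|]; apply: lp.
Qed.

Lemma cap_ideal l : (forall P, P \in l -> is_ideal P) -> is_ideal (cap l).
Proof.
move=> il; split=> [P /il/ideal0//|a u v lu lv P Pl].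
by apply: idealD; [exact: il|apply: idealM; [exact: il|exact: lu]|exact: lv].
Qed.

(** If every [Q] had an element outside [P], the product of these elements
    would be in the intersection but not in the prime [P]. *)
Lemma prime_avoid_cap P l : is_prime_ideal P ->
    (forall Q, Q \in l -> is_ideal Q) ->
  cap l `<=` P -> exists2 Q, Q \in l & Q `<=` P.
Proof.
move=> pP il lP; apply: contrapT => nQ.
suff [x lx] : exists2 x, cap l x & ~ P x by apply; apply: lP.
have {}nQ Q : Q \in l -> exists2 x, Q x & ~ P x.
  move=> Ql; apply: contrapT => nx; apply: nQ; exists Q => // x Qx.
  by apply: contrapT => Px; apply: nx; exists x.
elim: l il nQ {lP} => [|Q l IHl] il nQ.
  by exists 1 => //; apply: prime_proper.
have [||x lx Px] := IHl.
- by move=> Q' Q'l; apply: il; rewrite inE Q'l orbT.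
- by move=> Q' Q'l; apply: nQ; rewrite inE Q'l orbT.
have [y Qy Py] := nQ _ (mem_head _ _).
exists (y * x); last by move/(primeM pP)=> [].
rewrite cap_cons; split; first by apply: idealMr => //; apply: il; exact: mem_head.
move=> Q' Q'l; apply: idealM; first by apply: il; rewrite inE Q'l orbT.
exact: lx.
Qed.

(** The maximal condition is the form of the ascending chain condition that
    the arguments below use: each takes a maximal element of a well chosen
    family. *)
Definition noetherian : Prop :=
  forall F : set (set R), (forall J, F J -> is_ideal J) -> F !=set0 ->
    exists2 J, F J & forall J', F J' -> J `<=` J' -> J' = J.

Hypothesis noethR : noetherian.

(** Among the ideals [(I : a f)] with [a f] outside [I], a maximal one is
    prime, by the classical argument. It does not contain [f]: otherwise [(a
    f) ^ 2] would be in [I], hence [a f] as well, [I] being radical. *)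
Lemma exists_assoc_avoiding I f : is_ideal I -> radical I = I -> ~ I f ->
  exists2 P, assoc_prime I P & ~ P f.
Proof.
move=> iI radI nIf.
pose F := [set J | exists2 a, ~ I (a * f) & J = colon I (a * f)].
have [J [a nIaf defJ] maxJ] : exists2 J, F J &
    forall J', F J' -> J `<=` J' -> J' = J.
  apply: noethR; first by move=> J [a _ ->]; apply: colon_ideal.
  by exists (colon I (1 * f)), 1; rewrite ?mul1r.
exists J; last first.
  rewrite defJ /colon /= => Jf; apply: nIaf; rewrite -radI.
  exists 2%N => //; rewrite expr2 -mulrA.
  by apply: idealM.
split; last by exists (a * f).
apply/is_prime_idealP; split; first by rewrite defJ; apply: colon_ideal.
  by rewrite defJ /colon /= mul1r.
move=> u v Juv; have [Jv|nJv] := pselect (J v); [by right|left].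
have nIvaf : ~ I (v * a * f) by move: nJv; rewrite defJ /colon /= mulrA.
suff <- : colon I (v * a * f) = J.
  by move: Juv; rewrite defJ /colon /= !mulrA.
apply: maxJ; first by exists (v * a).
move=> w; rewrite defJ /colon /= => Iw.
by rewrite -(mulrA v) mulrCA; apply: idealM.
Qed.

(** For finite sets [l] of associated primes, the ideals [(I : cap l)] grow
    with [l]; let [l] be one for which this ideal is maximal. If [P = (I :
    g)] is not in [l], maximality gives [g (cap l) <= I], so that [cap l <=
    P] and [P] contains a member of [l], against incomparability. *)
Lemma finite_assoc I : is_ideal I ->
    (forall P Q, assoc_prime I P -> assoc_prime I Q -> P `<=` Q -> P = Q) ->
  exists2 l, uniq l & forall P, P \in l <-> assoc_prime I P.
Proof.
move=> iI anti.
pose G (L : set R) := [set x | forall y, L y -> I (x * y)].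
pose F := [set J | exists l, [/\ uniq l, forall P, P \in l -> assoc_prime I P
                               & J = G (cap l)]].
have [J [l [ul al defJ]] maxJ] : exists2 J, F J &
    forall J', F J' -> J `<=` J' -> J' = J.
  apply: noethR.
    move=> J [l [_ _ ->]]; split=> [y _|a u v Gu Gv y ly].
      by rewrite mul0r; apply: ideal0.
    rewrite mulrDl -mulrA; apply: idealD => //; last exact: Gv.
    by apply: idealM => //; apply: Gu.
  by exists (G (cap [::])), [::].
exists l => // P; split=> [/al//|aP]; apply: contrapT => /negP Pl.
have [pP [g defP]] := aP.
have Jg : J g.
  suff <- : G (cap (P :: l)) = J.
    by move=> y; rewrite cap_cons => -[+ _]; rewrite defP /colon /= mulrC.
  apply: maxJ.
    exists (P :: l); split=> //=; first by rewrite Pl.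
    by move=> Q; rewrite inE => /predU1P[->//|/al].
  move=> x; rewrite defJ => Gx y; rewrite cap_cons => -[_]; exact: Gx.
have [||Q Ql QP] := @prime_avoid_cap P l pP.
- by move=> Q /al[/prime_ideal].
- by move=> y ly; rewrite defP /colon /= mulrC; move: Jg; rewrite defJ; apply.
by move: Pl; rewrite -(anti Q P (al _ Ql) aP QP) Ql.
Qed.

Lemma radical_is_cap I : is_ideal I -> radical I = I ->
    (forall P Q, assoc_prime I P -> assoc_prime I Q -> P `<=` Q -> P = Q) ->
  exists l, [/\ uniq l, forall P, P \in l <-> assoc_prime I P & I = cap l].
Proof.
move=> iI radI /(finite_assoc iI)[l ul al]; exists l; split=> //.
apply/seteqP; split=> f.
  by move=> If P /al[_ [g ->]]; apply: idealMr.
move=> lf; apply: contrapT => /(exists_assoc_avoiding iI radI)[P /al Pl].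
by apply; apply: lf.
Qed.

End Ideals.

Section Noether.

(** Each term of the subsequence is a minimum of the sequence over all
    indices after the previous one. *)
Lemma nondecreasing_subseq (u : nat -> nat) : exists2 f : nat -> nat,
  {homo f : i j / (i < j)%N} & {homo u \o f : i j / (i <= j)%N}.
Proof.
have nextP N : exists n, (N < n)%N /\ forall k, (N < k)%N -> (u n <= u k)%N.
  have exv : exists v, `[< exists2 n, (N < n)%N & u n = v >].
    by exists (u N.+1); apply/asboolP; exists N.+1.
  case: (ex_minnP exv) => v /asboolP[n Nn <-] minv.
  by exists n; split=> // k Nk; apply: minv; apply/asboolP; exists k.
have [g gP] := choice nextP; pose f := fix f i := if i is j.+1 then g (f j) else g 0%N.
have flt : {homo f : i j / (i < j)%N}.
  by apply: (homo_ltn ltn_trans) => i; case: (gP (f i)).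
exists f => //; apply: (homo_leq leqnn leq_trans) => i /=.
case: i => [|i] /=; first by case: (gP 0%N) => h; apply; apply: ltn_trans h (gP _).1.
by case: (gP (f i)) => h; apply; apply: ltn_trans h (gP _).1.
Qed.

(** Coordinate by coordinate, a subsequence can be extracted along which the
    exponent does not decrease. *)
Lemma dickson n (u : nat -> 'X_{1..n}) :
  exists i j, (i < j)%N /\ (u i <= u j)%MM.
Proof.
suff [f flt fle] : exists2 f : nat -> nat, {homo f : i j / (i < j)%N} &
    forall c, c \in enum 'I_n -> {homo (fun i => u (f i) c) : i j / (i <= j)%N}.
  exists (f 0%N), (f 1%N); split; first exact: flt.
  by apply/mnm_lepP => c; apply: fle; rewrite // mem_enum.
elim: (enum 'I_n) => [|c r [f flt fle]]; first by exists id.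
have [g glt gle] := nondecreasing_subseq (fun i => u (f i) c).
exists (f \o g) => [i j ij /=|c']; first exact/flt/glt.
rewrite inE => /predU1P[->//|/fle c'le i j ij /=].
by apply: c'le; move: ij; rewrite leq_eqVlt => /predU1P[->//|/glt/ltnW].
Qed.

Variables (K : fieldType) (s : nat).
Notation S := {mpoly K[s]}.

(** Choose [f i] in [c i.+1] outside [c i] with least leading monomial. By
    Dickson's lemma the leading monomial of some [f i] divides that of a
    later [f j]; cancelling the leading term of [f j] by a multiple of [f i]
    gives an element outside [c j] with a smaller leading monomial. *)
Lemma mpoly_acc (c : nat -> set S) :
  (forall i, is_ideal (c i)) -> ~ forall i, c i `<` c i.+1.
Proof.
move=> ic clt.
have cle : {homo c : i j / (i <= j)%N >-> i `<=` j}.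
  apply: homo_leq => [A|B A C|i]; [by []|exact: subset_trans|exact: properW].
have exf i : exists f : S, [/\ c i.+1 f, ~ c i f &
    forall g, c i.+1 g -> ~ c i g -> ~~ (mlead g < mlead f)%O].
  apply: contrapT => nf; have [_ /existsNP[f /not_implyP[cf ncf]]] := clt i.
  have [m mE] : exists m, m = mlead f by exists (mlead f).
  elim/(@ltmwf s): m f mE cf ncf => m IHm f fE cf ncf.
  apply: nf; exists f; split=> // g cg ncg; apply/negP => gf.
  by apply: (IHm (mlead g)) cg ncg; rewrite // fE.
have [f fP] := choice exf.
have [i [j [ij le_ij]]] := dickson (fun i => mlead (f i)).
have [cfi ncfi _] := fP i; have [cfj ncfj minj] := fP j.
pose m := (mlead (f j) - mlead (f i))%MM.
pose a := mleadc (f j) / mleadc (f i).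
pose g := f j - a *: 'X_[m] * f i.
have cXf : c j (a *: 'X_[m] * f i) by apply: idealM => //; apply: cle cfi.
have nz_fi : f i != 0 by apply/eqP => fi0; apply: ncfi; rewrite fi0; apply: ideal0.
have cg : c j.+1 g by apply: idealB => //; apply: cle cXf.
have ncg : ~ c j g.
  by move=> cg'; apply: ncfj; rewrite -[f j](subrK (a *: 'X_[m] * f i)); apply: idealD.
have nz_g : g != 0 by apply/eqP => g0; apply: ncg; rewrite g0; apply: ideal0.
have mE : (m + mlead (f i))%MM = mlead (f j) by rewrite submK.
have := minj g cg ncg; apply/negP; rewrite negbK lt_neqAle; apply/andP; split.
  apply: contra_neq nz_g => gj; apply/eqP; rewrite -mleadc_eq0 gj.
  have Xfi : ('X_[m] * f i)@_(mlead (f j)) = mleadc (f i).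
    by rewrite mulrC -mE mcoeffMX.
  by rewrite mcoeffB -scalerAl mcoeffZ Xfi divfK ?subrr ?mleadc_eq0.
apply: le_trans (mleadB_le _ _) _; rewrite leUx lexx /= -scalerAl.
apply: le_trans (mleadZ_le _ _) _; apply: le_trans (mleadM_le _ _) _.
by rewrite mleadXm mE.
Qed.

Lemma mpoly_noetherian : noetherian {mpoly K[s]}.
Proof.
move=> F idF [J0 FJ0]; apply: contrapT => nmax.
have nextP (J : {J | F J}) : exists J' : {J | F J}, sval J `<` sval J'.
  apply: contrapT => nJ'; apply: nmax; exists (sval J) => [|J' FJ' JJ'].
    exact: (svalP J).
  apply: contrapT => neJ; apply: nJ'; exists (exist _ J' FJ'); split=> // J'J.
  by apply: neJ; apply/seteqP; split.
have [g gP] := choice nextP.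
pose c i := iter i g (exist _ J0 FJ0).
apply: (@mpoly_acc (fun i => sval (c i))) => i; first exact/idF/(svalP (c i)).
exact: gP.
Qed.

End Noether.

(** * Chains of primes in a polynomial ring *)

Section Chains.
Variables (K : fieldType) (s : nat).
Notation S := {mpoly K[s]}.
Implicit Types (W P : set S).

(** Linear independence in the quotient by [W]; for [W = 0] it is linear
    independence. *)
Definition independent (T : finType) W (b : T -> S) : Prop :=
  forall a : T -> K, W (\sum_t a t *: b t) -> forall t, a t = 0.

(** In a relation that lies in [P], let [x ^ i] be the least power of [x]
    with a nonzero coefficient [w]. Dividing by [x ^ i], which is not in the
    prime [P], gives [w + x r] in [P], so [w] is in [Q] as [x] is; but [w] is
    a combination of the [b t]. *)
Lemma independent_powers (T : finType) P Q (b : T -> S) x N :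
    is_prime_ideal P -> P `<=` Q -> is_ideal Q -> ~ P x -> Q x ->
    independent Q b ->
  independent P (fun t : 'I_N * T => x ^+ t.1 * b t.2).
Proof.
move=> pP PQ iQ nPx Qx bfree a Pa [i t] /=.
have iP := prime_ideal pP.
elim/ltn_ind: {i}(val i) {-2}i (erefl (val i)) t => n IHn i iE t.
pose w (j : 'I_N) := \sum_t a (j, t) *: b t.
have sumE : \sum_u a u *: (x ^+ u.1 * b u.2) = \sum_(j < N) x ^+ j * w j.
  transitivity (\sum_(j < N) \sum_t a (j, t) *: (x ^+ j * b t)).
    by rewrite pair_bigA; apply: eq_bigr => -[j u] _.
  apply: eq_bigr => j _; rewrite mulr_sumr.
  by apply: eq_bigr => u _; rewrite scalerAr.
have w0 (j : 'I_N) : (j < i)%N -> w j = 0.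
  by move=> ji; apply: big1 => u _; rewrite (IHn j) ?scale0r -?iE.
suff Qwi : Q (w i) by apply: (bfree (fun t => a (i, t))).
(* The part of the relation beyond the power [x ^ i], divided by [x ^ i.+1]. *)
pose r := \sum_(j < N | (i < j)%N) x ^+ (j - i.+1) * w j.
have fact : \sum_u a u *: (x ^+ u.1 * b u.2) = x ^+ i * (w i + x * r).
  rewrite sumE mulrDr (bigD1 i) //=; congr (_ + _).
  rewrite !mulr_sumr big_mkcond [RHS]big_mkcond; apply: eq_bigr => j _.
  case: (ltngtP j i) => [/w0->|ij|/val_inj->]; rewrite ?mulr0 ?if_same //.
    by rewrite !mulrA -exprSr -exprD subnKC // ifT // neq_ltn ij orbT.
  by rewrite eqxx.
have : P (w i + x * r).
  by move: Pa; rewrite fact => /(primeM pP)[/(prime_exp pP)|].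
move/PQ => Qwr; rewrite -[w i](addrK (x * r)); apply: idealB => //.
exact: idealMr.
Qed.

Definition deg_le (d : nat) (p : S) : Prop := (msize p <= d.+1)%N.

Lemma deg_leM d e p q : deg_le d p -> deg_le e q -> deg_le (d + e) (p * q).
Proof.
rewrite /deg_le => dp eq.
have [->|nz_p] := eqVneq p 0; first by rewrite mul0r msize0.
have [->|nz_q] := eqVneq q 0; first by rewrite mulr0 msize0.
rewrite msizeM_proper ?mulf_neq0 ?mleadc_eq0 //.
rewrite -subn1 leq_subLR; apply: leq_trans (leq_add dp eq) _.
by rewrite addSn addnS add1n.
Qed.

Lemma deg_leX d p n : deg_le d p -> deg_le (d * n) (p ^+ n).
Proof.
move=> dp; elim: n => [|n IHn]; first by rewrite /deg_le expr0 msize1.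
by rewrite exprS mulnS; apply: deg_leM.
Qed.

Lemma deg_le_trans d e p : (d <= e)%N -> deg_le d p -> deg_le e p.
Proof. by move=> de dp; apply: leq_trans dp _. Qed.

(** A polynomial of degree at most [d] is determined by its coefficients on
    the [d.+1 ^ s] monomials whose exponents are all at most [d]. *)
Lemma independent_deg_card (T : finType) (b : T -> S) W d :
  W 0 -> independent W b -> (forall t, deg_le d (b t)) -> (#|T| <= d.+1 ^ s)%N.
Proof.
move=> W0 bfree db.
pose U := {ffun 'I_s -> 'I_d.+1}.
pose mon (u : U) : 'X_{1..s} := [multinom u i : nat | i < s].
pose A := \matrix_(i < #|T|, j < #|U|) (b (enum_val i))@_(mon (enum_val j)).
suff : row_free A.
  move=> /eqP <-; apply: leq_trans (rank_leq_col _) _.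
  by rewrite card_ffun !card_ord.
rewrite -kermx_eq0; apply/rowV0P => v /sub_kermxP vA.
have b0 : \sum_t v 0 (enum_rank t) *: b t = 0.
  apply/mpolyP => m; rewrite mcoeff0 raddf_sum /=.
  have [md|md] := leqP (mdeg m) d; last first.
    apply: big1 => t _; rewrite mcoeffZ memN_msupp_eq0 ?mulr0 //.
    by apply: msize_mdeg_ge; apply: leq_trans (db t) md.
  have mlt i : (m i < d.+1)%N.
    by rewrite ltnS; apply: leq_trans md; rewrite mdegE (bigD1 i) //= leq_addr.
  pose u : U := [ffun i => Ordinal (mlt i)].
  have uE : mon u = m by apply/mnmP => i; rewrite mnmE ffunE.
  transitivity ((v *m A) 0 (enum_rank u)); last by rewrite vA mxE.
  rewrite mxE [RHS](reindex enum_rank); last exact/onW_bij/enum_rank_bij.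
  by apply: eq_bigr => t _; rewrite mxE mcoeffZ !enum_rankK uE.
have v0 := bfree (fun t => v 0 (enum_rank t)).
apply/rowP => i; rewrite mxE -[i]enum_valK; apply: v0.
by rewrite b0.
Qed.

(** Going down the chain, [independent_powers] yields [N ^ n] independent
    polynomials whose degrees are bounded by a multiple of [N];
    [independent_deg_card] bounds their number by a polynomial in [N] of
    degree [s]. *)
Lemma prime_chain_bound n (c : nat -> set S) : prime_chain n c -> (n <= s)%N.
Proof.
move=> [pc clt]; rewrite leqNgt; apply/negP => sn.
have exx i : exists x, (i < n)%N -> c i.+1 x /\ ~ c i x.
  case: (ltnP i n) => [lt_in|_]; last by exists 0.
  by have [_ /existsNP[x /not_implyP cx]] := clt i lt_in; exists x.
have [x xP] := choice exx.
pose D := (\max_(i < n) msize (x i))%N.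
have degx i : (i < n)%N -> deg_le D (x i).
  move=> lt_in; apply: leqW.
  exact: (@leq_bigmax _ (fun i : 'I_n => msize (x i)) (Ordinal lt_in)).
have fam N j : (j <= n)%N -> exists (T : finType) (b : T -> S),
    [/\ independent (c (n - j)%N) b, #|T| = (N ^ j)%N &
        forall t, deg_le (j * (D * N)) (b t)].
  elim: j => [_|j IHj jn].
    exists unit, (fun=> 1); split; [|by rewrite card_unit|]; last first.
      by move=> t; rewrite /deg_le msize1.
    rewrite subn0 => a; have pn := pc n (leqnn _).
    rewrite (big_pred1 tt) => [ca [] | []//].
    apply: contrapT => /eqP nza; apply: (prime_proper pn).
    by rewrite -(scalerK nza 1) -mul_mpolyC; apply: idealM; first exact: prime_ideal.
  have [T [b [bfree cT degb]]] := IHj (ltnW jn).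
  have nj : (n - j.+1 < n)%N by rewrite ltn_subrL (leq_trans _ jn).
  have njS : (n - j.+1).+1 = (n - j)%N by rewrite subnSK.
  have [cx ncx] := xP _ nj; rewrite njS in cx.
  exists ('I_N * T)%type, (fun t : 'I_N * T => x (n - j.+1)%N ^+ t.1 * b t.2); split.
  - apply: independent_powers ncx cx bfree; first by apply: pc; apply: leq_subr.
      by rewrite -njS; apply: properW; apply: clt.
    by apply: prime_ideal; apply: pc; apply: leq_subr.
  - by rewrite card_prod card_ord cT expnS.
  move=> [i t] /=; rewrite mulSn; apply: deg_leM => //.
  apply: deg_le_trans (deg_leX i (degx _ nj)).
  by rewrite leq_mul2l ltnW ?orbT.
(* If [s < n], this choice gives [N ^ n >= N ^ s * N > (n D N + 1) ^ s]. *)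
pose N := ((n * D).+1 ^ s).+1.
have [T [b [bfree cT degb]]] := fam N n (leqnn n); rewrite subnn in bfree.
have := independent_deg_card (ideal0 (prime_ideal (pc 0%N (leq0n n)))) bfree degb.
rewrite cT leqNgt => /negP; apply.
apply: (@leq_ltn_trans ((N * (n * D).+1) ^ s)).
  have [->|s0] := posnP s; first by rewrite !expn0.
  rewrite leq_exp2r // mulnS [X in (_ <= _ + X)%N]mulnC -mulnA -add1n.
  exact: leq_add.
apply: (@leq_trans (N ^ s.+1)); last by rewrite leq_pexp2l.
by rewrite expnMn expnSr ltn_pmul2l ?expn_gt0.
Qed.

End Chains.

(** * Linear substitutions and ideals generated by linear forms *)

Section LinearForms.
Variable K : fieldType.

Definition lform n (v : 'rV[K]_n) : {mpoly K[n]} := \sum_i v 0 i *: 'X_i.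

Lemma lform_linear n : linear (@lform n).
Proof.
move=> a u v; rewrite /lform scaler_sumr -big_split; apply: eq_bigr => i _ /=.
by rewrite !mxE scalerDl scalerA.
Qed.

HB.instance Definition _ n :=
  GRing.isLinear.Build K 'rV[K]_n {mpoly K[n]} _ (@lform n) (@lform_linear n).

Lemma mcoeff_lform n (v : 'rV[K]_n) i : (lform v)@_U_(i) = v 0 i.
Proof.
rewrite raddf_sum (bigD1 i) //= big1 => [|j /negPf ji].
  by rewrite mcoeffZ mcoeffXU eqxx mulr1 addr0.
by rewrite mcoeffZ mcoeffXU ji mulr0.
Qed.

Lemma lform_inj n : injective (@lform n).
Proof.
by move=> u v uv; apply/rowP => i; rewrite -!mcoeff_lform uv.
Qed.

Lemma lform_homog n (v : 'rV[K]_n) : lform v \is 1.-homog.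
Proof. by apply: rpred_sum => i _; apply: rpredZ; rewrite dhomogX; apply/eqP/mdeg1. Qed.

Lemma lform_delta n (i : 'I_n) : lform (delta_mx 0 i) = 'X_i.
Proof.
rewrite /lform (bigD1 i) //= big1 => [|j /negPf ji].
  by rewrite mxE !eqxx scale1r addr0.
by rewrite mxE ji andbF scale0r.
Qed.

Lemma homog1_lform n (p : {mpoly K[n]}) : p \is 1.-homog ->
  p = lform (\row_i p@_U_(i)).
Proof.
move=> hp; apply/mpolyP => m.
have [/eqP/mdeg1P[i /eqP->]|m1] := eqVneq (mdeg m) 1%N.
  by rewrite mcoeff_lform mxE.
by rewrite !(@dhomog_nemf_coeff _ _ mdeg 1) //; apply: lform_homog.
Qed.

(** The images of the variables under the substitution with matrix [M]; it
    acts on linear forms by right multiplication of row vectors by [M]. *)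
Definition lforms s n (M : 'M[K]_(s, n)) : s.-tuple {mpoly K[n]} :=
  [tuple lform (row i M) | i < s].

Notation lsub M := (comp_mpoly (lforms M)).

Lemma lsubX s n (M : 'M[K]_(s, n)) i : lsub M 'X_i = lform (row i M).
Proof. by rewrite comp_mpolyXU -tnth_nth tnth_mktuple. Qed.

Lemma lsub_lform s n (M : 'M[K]_(s, n)) v : lsub M (lform v) = lform (v *m M).
Proof.
rewrite /lform raddf_sum /=.
under eq_bigr do rewrite comp_mpolyZ lsubX.
rewrite -/(lform _) mulmx_sum_row raddf_sum /=.
by apply: eq_bigr => i _; rewrite linearZ.
Qed.

Lemma mpoly_ind_ring s (T : {mpoly K[s]} -> Prop) :
    (forall c, T c%:MP) -> (forall i, T 'X_i) ->
    (forall p q, T p -> T q -> T (p + q)) ->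
    (forall p q, T p -> T q -> T (p * q)) ->
  forall p, T p.
Proof.
move=> TC TX TD TM p; rewrite [p]mpolyE.
apply: big_ind => [|x y Tx Ty|m _]; [by rewrite -mpolyC0|exact: TD|].
rewrite -mul_mpolyC; apply: (TM) => //; rewrite mpolyXE_id.
apply: big_ind => [|x y Tx Ty|i _]; [by rewrite -mpolyC1|exact: TM|].
elim: (m i) => [|k IHk]; first by rewrite expr0 -mpolyC1.
by rewrite exprS; apply: TM.
Qed.

Lemma lsub_comp s n m (M : 'M[K]_(s, n)) (N : 'M[K]_(n, m)) p :
  lsub N (lsub M p) = lsub (M *m N) p.
Proof.
elim/mpoly_ind_ring: p => [c|i|p q IHp IHq|p q IHp IHq].
- by rewrite !comp_mpolyC.
- by rewrite !lsubX lsub_lform row_mul.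
- by rewrite !raddfD /= IHp IHq.
- by rewrite !rmorphM /= IHp IHq.
Qed.

Lemma lsub1 s (p : {mpoly K[s]}) : lsub 1%:M p = p.
Proof.
elim/mpoly_ind_ring: p => [c|i|p q IHp IHq|p q IHp IHq].
- by rewrite comp_mpolyC.
- by rewrite lsubX row1 lform_delta.
- by rewrite raddfD /= IHp IHq.
- by rewrite rmorphM /= IHp IHq.
Qed.

Lemma lsub_homog s n (M : 'M[K]_(s, n)) d p :
  p \is d.-homog -> lsub M p \is d.-homog.
Proof.
move=> /dhomogP hp; rewrite comp_mpolyEX big_seq; apply: rpred_sum => m mp.
apply: rpredZ; rewrite comp_mpolyX -(hp m mp) /= mdegE.
elim/big_ind2: _ => [|d1 p1 d2 p2 hp1 hp2|i _]; first exact: dhomog1.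
  exact: dhomogM.
rewrite tnth_mktuple; have := dhomogMn (m i) (lform_homog (row i M)).
by rewrite mul1n.
Qed.

Lemma pihomog_lsub s n (M : 'M[K]_(s, n)) d p :
  pihomog mdeg d (lsub M p) = lsub M (pihomog mdeg d p).
Proof.
pose k := maxn (msize p) d.+1.
have lsubE : lsub M p = \sum_(i < k) lsub M (pihomog mdeg i p).
  by rewrite -raddf_sum -pihomog_partitionE ?leq_maxl.
have ltd : (d < k)%N by rewrite leq_max ltnSn orbT.
rewrite lsubE (raddf_sum (pihomog mdeg d)) (bigD1 (Ordinal ltd)) //=.
rewrite big1 => [|i id].
  by rewrite addr0 pihomog_dE //; apply: lsub_homog; apply: pihomogP.
by rewrite (@pihomog_ne0 _ _ mdeg i) //; apply: lsub_homog; apply: pihomogP.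
Qed.

Definition lker_ideal s n (M : 'M[K]_(s, n)) : set {mpoly K[s]} :=
  [set p | lsub M p = 0].

Lemma lker_ideal_prime s n (M : 'M[K]_(s, n)) : is_prime_ideal (lker_ideal M).
Proof.
apply/is_prime_idealP; rewrite /lker_ideal /=; split.
- split=> [|a u v /= u0 v0]; first exact: raddf0.
  by rewrite raddfD /= rmorphM /= u0 v0 mulr0 addr0.
- by rewrite rmorph1; apply/eqP/oner_neq0.
move=> u v /=; rewrite rmorphM /= => /eqP; rewrite mulf_eq0.
by case/orP=> /eqP; [left|right].
Qed.

Lemma lker_ideal_graded s n (M : 'M[K]_(s, n)) : graded (lker_ideal M).
Proof. by move=> p; rewrite /lker_ideal /= => p0 d; rewrite -pihomog_lsub p0 raddf0. Qed.

Lemma lker_ideal_lform s n (M : 'M[K]_(s, n)) v :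
  lker_ideal M (lform v) <-> v *m M = 0.
Proof.
rewrite /lker_ideal /= lsub_lform; split=> [|->]; last exact: raddf0.
by rewrite -(raddf0 (@lform n)) => /lform_inj.
Qed.

Lemma lker_ideal_sub s n m (M : 'M[K]_(s, n)) (N : 'M[K]_(n, m)) :
  lker_ideal M `<=` lker_ideal (M *m N).
Proof. by move=> p; rewrite /lker_ideal /= -lsub_comp => ->; apply: raddf0. Qed.

(** The polynomials congruent to their image under the substitution form a
    subring, which contains the constants; it is enough to test the
    variables. *)
Lemma lsub_mod s (N : 'M[K]_s) (J : set {mpoly K[s]}) p : is_ideal J ->
  (forall i, J ('X_i - lform (row i N))) -> J (p - lsub N p).
Proof.
move=> iJ JX; elim/mpoly_ind_ring: p => [c|i|p q IHp IHq|p q IHp IHq].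
- by rewrite comp_mpolyC subrr; apply: ideal0.
- by rewrite lsubX.
- by rewrite raddfD /= opprD addrACA; apply: idealD.
rewrite rmorphM /=.
have -> : p * q - lsub N p * lsub N q =
    q * (p - lsub N p) + lsub N p * (q - lsub N q).
  by rewrite !mulrBr (mulrC q p) (mulrC q) addrA subrK.
by apply: idealD => //; apply: idealM.
Qed.

(** With [Z = M (pinvmx M)] one has [Z M = M], so each [t_i] differs from its
    image under [Z] by a linear form killed by [M]. By [lsub_mod] a
    polynomial [p] is congruent to its image under [Z] modulo these forms,
    and this image is zero if [p] is in the kernel of the substitution [M]. *)
Lemma lker_ideal_gen s n (M : 'M[K]_(s, n)) :
  lker_ideal M = ideal_gen [set p | exists2 v, v *m M = 0 & p = lform v].
Proof.
apply/seteqP; split; last first.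
  apply: ideal_gen_sub; first exact/prime_ideal/lker_ideal_prime.
  by move=> p [v vM ->]; apply/lker_ideal_lform.
move=> p; rewrite /lker_ideal /= => p0.
set J := ideal_gen _; have iJ : is_ideal J by apply: ideal_gen_ideal.
rewrite -[p]subr0 -(raddf0 (comp_mpoly (lforms (pinvmx M)))) /= -p0 lsub_comp.
apply: lsub_mod => // i; rewrite -lform_delta -raddfB.
apply: sub_ideal_gen; exists (delta_mx 0 i - row i (M *m pinvmx M)) => //.
by rewrite mulmxBl -rowE -row_mul mulmxKpV ?subrr.
Qed.

(** A subspace of largest dimension contained in [W] is all of [W], since it
    could otherwise be enlarged by a vector of [W]. *)
Lemma vspace_of_set (vT : vectType K) (W : set vT) :
    W 0 -> (forall a u v, W u -> W v -> W (a *: u + v)) ->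
  exists U : {vspace vT}, forall v, v \in U <-> W v.
Proof.
move=> W0 Wlin.
pose good r := `[< exists2 U : {vspace vT}, \dim U = r & forall v, v \in U -> W v >].
have ex : exists r, good r.
  exists 0%N; apply/asboolP; exists 0%VS; first exact: dimv0.
  by move=> v; rewrite memv0 => /eqP->.
have ub r : good r -> (r <= \dim {:vT})%N.
  by move=> /asboolP[U <- _]; apply/dimvS/subvf.
case: (ex_maxnP ex ub) => r /asboolP[U rU UW] maxr.
exists U => v; split=> [/UW//|Wv].
have : (\dim (U + <[v]>) <= \dim U)%N.
  rewrite rU; apply: maxr; apply/asboolP; exists (U + <[v]>)%VS => // w.
  by move=> /memv_addP[u /UW Wu [_ /vlineP[a ->] ->]]; rewrite addrC; apply: Wlin.
rewrite (geq_leqif (dimv_leqif_sup (addvSl U <[v]>))).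
by rewrite subv_add => /andP[_].
Qed.

Lemma row_subspace_mx s (W : set 'rV[K]_s) :
    W 0 -> (forall a u v, W u -> W v -> W (a *: u + v)) ->
  exists A : 'M[K]_s, forall v, W v <-> (v <= A)%MS.
Proof.
move=> W0 /(vspace_of_set W0)[U UW].
pose B := \matrix_(i < \dim U) tnth (vbasis U) i.
exists <<B>>%MS => v; rewrite genmxE; split.
  move=> /UW/coord_vbasis ->; apply: summx_sub => i _; apply: scalemx_sub.
  have <- : row i B = (vbasis U)`_i by rewrite rowK (tnth_nth 0).
  exact: row_sub.
move=> /submxP[a ->]; apply/UW; rewrite mulmx_sum_row; apply: rpred_sum => i _.
by apply: rpredZ; rewrite rowK; apply/vbasis_mem/mem_tnth.
Qed.

(** [A] is a matrix whose rows span the linear forms in [P]; the columns of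
    its cokernel matrix are the equations of this row space. *)
Lemma linear_prime_lker s (P : set {mpoly K[s]}) (L : set {mpoly K[s]}) :
    L `<=` @homog_part K s 1 -> P = ideal_gen L ->
  exists A : 'M[K]_s, P = lker_ideal (cokermx A).
Proof.
move=> hL defP; have iP : is_ideal P by rewrite defP; apply: ideal_gen_ideal.
have [|a u v Pu Pv|A AP] := @row_subspace_mx s [set v | P (lform v)].
- by rewrite /= raddf0; apply: ideal0.
- have /= -> : lform (a *: u + v) = a%:MP * lform u + lform v.
    by rewrite mul_mpolyC; apply: lform_linear.
  by apply: idealD => //; apply: idealM.
exists A; apply/seteqP; split.
  rewrite {1}defP; apply: ideal_gen_sub; first exact/prime_ideal/lker_ideal_prime.
  move=> g Lg; have Pg : P g by rewrite defP; apply: sub_ideal_gen.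
  move: (hL g Lg) Pg => /homog1_lform -> /(AP _).
  by rewrite submxE => /eqP/lker_ideal_lform.
rewrite lker_ideal_gen; apply: ideal_gen_sub => // g [v /eqP + ->].
by rewrite -submxE => /AP.
Qed.

(** After the change of coordinates given by [row_ebase A], this is the ideal
    generated by the first [i] variables. The first [\rank A] of these span
    the row space of [A], so the ideal of [A] is one of the members of the
    flag. *)
Definition flag_ideal s (A : 'M[K]_s) (i : nat) : set {mpoly K[s]} :=
  lker_ideal (invmx (row_ebase A) *m copid_mx i).

Lemma flag_ideal_rank s (A : 'M[K]_s) :
  flag_ideal A (\rank A) = lker_ideal (cokermx A).
Proof. by []. Qed.

Lemma flag_chain s (A : 'M[K]_s) : prime_chain s (flag_ideal A).
Proof.
split=> [i _|i lt_is]; first exact: lker_ideal_prime.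
split.
  have -> : flag_ideal A i.+1 =
      lker_ideal (invmx (row_ebase A) *m copid_mx i *m copid_mx i.+1).
    rewrite /flag_ideal -mulmxA; congr (lker_ideal (_ *m _)).
    rewrite /copid_mx mulmxBl mul1mx mulmxBr mulmx1 mul_pid_mx.
    by rewrite (minn_idPl (leqnSn i)) (minn_idPr (ltnW lt_is)) subrr subr0.
  exact: lker_ideal_sub.
pose o := Ordinal lt_is; pose e : 'rV[K]_s := delta_mx 0 o *m row_ebase A.
have lformE j : flag_ideal A j (lform e) <-> row o (copid_mx j : 'M[K]_s) = 0.
  have <- : e *m (invmx (row_ebase A) *m copid_mx j) = row o (copid_mx j).
    by rewrite mulmxA mulmxK ?row_ebase_unit // -rowE.
  exact: lker_ideal_lform.
move=> /(_ (lform e)); rewrite !lformE => sub.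
have /sub/rowP/(_ o) : row o (copid_mx i.+1 : 'M[K]_s) = 0.
  apply/rowP => j; rewrite !mxE /= ltnSn andbT.
  by rewrite -val_eqE; case: eqP; rewrite subrr.
by rewrite !mxE eqxx /= ltnn andbF subr0 => /eqP; rewrite oner_eq0.
Qed.

End LinearForms.
Notation lsub M := (comp_mpoly (lforms M)).

(** * Height and Krull dimension *)

Section Dimension.

Lemma set_maxE (A : set nat) n :
  A n -> (forall m, A m -> (m <= n)%N) -> set_max A = n.
Proof.
move=> An ubn; have /xgetPex-/(_ 0%N)[] : exists m, (A `&` ubound A) m.
  by exists n; split=> // m Am; apply: ubn.
rewrite -/(set_max A) => Am ubm.
by apply/eqP; rewrite eqn_leq ubn //=; apply: ubm.
Qed.

Lemma prime_chain_cat (R : comNzRingType) m n (b c : nat -> set R) :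
    prime_chain m b -> prime_chain n c -> b m `<=` c 0%N ->
  exists d : nat -> set R, prime_chain (m + n) d.
Proof.
move=> [pb ltb] [pc ltc] bc.
exists (fun i => if (i <= m)%N then b i else c (i - m)%N); split=> i.
  case: (leqP i m) => [im _|mi imn]; first exact: pb.
  by apply: pc; rewrite leq_subLR.
move=> imn; have [lt_im|gt_im|im] := ltngtP i m.
- exact: ltb.
- by rewrite subSn ?(ltnW gt_im) //; apply: ltc; rewrite ltn_subLR ?(ltnW gt_im).
subst i; have [|c01 c10] := ltc 0%N; first by lia.
rewrite subSnn; split; first exact: subset_trans bc c01.
by move=> c1b; apply: c10; apply: subset_trans bc.
Qed.

Variables (K : fieldType) (s : nat).
Notation S := {mpoly K[s]}.
Implicit Types (A : 'M[K]_s) (J P Q : set S).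

Lemma flag_chain_below A i : (i <= s)%N -> prime_chain i (flag_ideal A).
Proof.
move=> le_is; have [pA ltA] := flag_chain A; split=> j ji.
  by apply: pA; apply: leq_trans le_is.
by apply: ltA; apply: leq_trans le_is.
Qed.

Lemma flag_chain_above A i : (i <= s)%N ->
  prime_chain (s - i) (fun j => flag_ideal A (i + j)).
Proof.
move=> le_is; have [pA ltA] := flag_chain A; split=> j ji.
  by apply: pA; rewrite -leq_subRL.
by rewrite addnS; apply: ltA; rewrite -ltn_subRL.
Qed.

(** A chain of length [n] below this prime can be continued by the part of
    the flag above it, of length [s - \rank A]; the total is at most [s]. The
    part of the flag below it has length [\rank A]. *)
Lemma height_lker A : height (lker_ideal (cokermx A)) = \rank A.
Proof.
have le_rs := rank_leq_row A.
rewrite -flag_ideal_rank; apply: set_maxE => [|n [c cc cP]].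
  by exists (flag_ideal A) => //; apply: flag_chain_below.
have [|d /prime_chain_bound] := prime_chain_cat cc (flag_chain_above A le_rs).
  by rewrite cP addn0.
by move=> h; lia.
Qed.

(** A chain of primes over [J] can be preceded by the part of a flag below
    the linear prime [B] that its first member contains, so its length is at
    most [s - \rank A]; the flag above the ideal of [A] reaches this length. *)
Lemma krull_dim_linear J A :
    J `<=` lker_ideal (cokermx A) ->
    (forall Q, is_prime_ideal Q -> J `<=` Q ->
      exists2 B : 'M[K]_s, \rank B = \rank A & lker_ideal (cokermx B) `<=` Q) ->
  krull_dim_quot J = (s - \rank A)%N.
Proof.
move=> JA minJ; have le_rs := rank_leq_row A; apply: set_maxE => [|n [c cc Jc]].
  exists (fun j => flag_ideal A (\rank A + j)); first exact: flag_chain_above.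
  by rewrite addn0.
have [|B rB BQ] := minJ (c 0%N) _ Jc; first by apply: cc.1.
have := prime_chain_cat (flag_chain_below B (rank_leq_row B)) cc.
rewrite flag_ideal_rank => /(_ BQ)[d /prime_chain_bound].
by rewrite rB => h; lia.
Qed.

End Dimension.

(** * Hilbert functions as dimensions of homogeneous parts *)

Section Hilbert.
Variables (K : fieldType) (n : nat).
Notation S := {mpoly K[n.+1]}.
Notation V d := (dhomog n.+1 K d).
Implicit Types (I J P Q : set S).

Lemma idealZ J a p : is_ideal J -> J p -> J (a *: p).
Proof. by move=> iJ Jp; rewrite -mul_mpolyC; apply: idealM. Qed.

(** The homogeneous part of degree [d] of an ideal, as a subspace, so that
    dimension formulas apply; [hpartP] shows that it exists. *)
Definition hpart J d : {vspace V d} :=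
  xget 0%VS [set U : {vspace V d} | forall v, v \in U <-> J (val v)].

Lemma hpartP J d (v : V d) : is_ideal J -> v \in hpart J d <-> J (val v).
Proof.
move=> iJ; rewrite /hpart; case: xgetP => [U _ ->//|noU]; exfalso.
have [||U JU] := @vspace_of_set _ _ [set v : V d | J (val v)].
- exact: ideal0.
- by move=> a u w Ju Jw; apply: idealD => //; apply: idealZ.
exact: noU JU.
Qed.

(** A basis of a complement of [hpart J d] is independent modulo [J], and a
    family independent modulo [J] spans a subspace that meets [hpart J d]
    trivially. *)
Lemma hilbert_dim J d : is_ideal J ->
  (hilbert_fun J d + \dim (hpart J d))%N = \dim {:V d}.
Proof.
move=> iJ; set U := hpart J d.
have leU : (\dim U <= \dim {:V d})%N by apply/dimvS/subvf.
suff -> : hilbert_fun J d = (\dim {:V d} - \dim U)%N by rewrite subnK.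
have sumE m (c : 'I_m -> K) (X : m.-tuple (V d)) :
    val (\sum_i c i *: tnth X i) = \sum_i c i *: val (tnth X i) :> S.
  exact: (linear_sum (@mpoly_of_dhomog _ _ _)).
apply: set_maxE => [|m [b hb bfree]].
  rewrite -dimv_compl; pose X := vbasis U^C.
  exists (fun i => val (tnth X i)) => [i|c /=].
    exact: dhomog_is_dhomog.
  rewrite -sumE => -[_ /(hpartP _ iJ)]; rewrite -/U => Uv.
  have /freeP Xfree : free X := basis_free (vbasisP _).
  move: Uv; rewrite (eq_bigr (fun i => c i *: X`_i)) => [|i _]; last first.
    by rewrite (tnth_nth 0).
  move=> Uv; apply: Xfree; apply/eqP.
  rewrite -memv0 -(capv_compl U) memv_cap Uv /=; apply: rpred_sum => i _.
  by apply: rpredZ; apply: vbasis_mem; rewrite -tnth_nth mem_tnth.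
pose X := [tuple DHomog (hb i) | i < m].
have indepX (c : 'I_m -> K) : \sum_i c i *: tnth X i \in U -> forall i, c i = 0.
  move=> /(hpartP _ iJ); rewrite sumE => Jc; apply: bfree.
  rewrite (eq_bigr (fun i => c i *: val (tnth X i))) => [|i _].
    by split=> //; rewrite -sumE; apply: dhomog_is_dhomog.
  by rewrite tnth_mktuple.
have Xfree : free X.
  apply/freeP => c; rewrite (eq_bigr (fun i => c i *: tnth X i)) => [c0|i _].
    by apply: indepX; rewrite c0 mem0v.
  by rewrite (tnth_nth 0).
have capX : (<<X>> :&: U)%VS = 0%VS.
  apply/eqP; rewrite -subv0; apply/subvP => v; rewrite memv_cap => /andP[vX vU].
  rewrite memv0 (coord_span vX) big1 // => i _.
  rewrite (indepX (fun i => coord X i v)) ?scale0r //.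
  suff <- : v = \sum_i coord X i v *: tnth X i by [].
  rewrite {1}(coord_span vX); apply: eq_bigr => j _; by rewrite (tnth_nth 0).
have <- : \dim <<X>> = m by rewrite (eqP Xfree) size_tuple.
by rewrite leq_subRL // addnC -dimv_disjoint_sum //; apply/dimvS/subvf.
Qed.

Lemma dim_homog d : \dim {:V d} = 'C(d + n, n).
Proof. by rewrite dimvf -[RHS]bin_sub ?leq_addl // addnK. Qed.

Lemma hpart_setI I J d : is_ideal I -> is_ideal J ->
  hpart (I `&` J) d = (hpart I d :&: hpart J d)%VS.
Proof.
move=> iI iJ; have iIJ := idealI iI iJ.
apply/vspaceP => v; rewrite memv_cap; apply/idP/andP.
  by move=> /(hpartP _ iIJ)[Iv Jv]; split; apply/hpartP.
by move=> [/(hpartP _ iI) Iv /(hpartP _ iJ) Jv]; apply/hpartP.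
Qed.

Lemma pihomog_mulr d e a f : f \is e.-homog ->
  pihomog mdeg (d + e) (a * f) = pihomog mdeg d a * f :> S.
Proof.
move=> hf; pose k := maxn (msize a) d.+1.
have aE : a * f = \sum_(i < k) pihomog mdeg i a * f.
  by rewrite -mulr_suml -pihomog_partitionE ?leq_maxl.
have ltd : (d < k)%N by rewrite leq_max ltnSn orbT.
rewrite aE (raddf_sum (pihomog mdeg (d + e))) (bigD1 (Ordinal ltd)) //=.
rewrite big1 => [|i id].
  by rewrite addr0 pihomog_dE //; apply: dhomogM => //; apply: pihomogP.
rewrite (@pihomog_ne0 _ _ mdeg (i + e)%N) ?eqn_add2r //.
by apply: dhomogM => //; apply: pihomogP.
Qed.

Section MulForm.
Variables (d e : nat) (f : S).
Hypothesis hf : f \is e.-homog.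

Definition mul_form (v : V d) : V (d + e) := DHomog (dhomogM (dhomog_is_dhomog v) hf).

Lemma mul_form_linear : linear mul_form.
Proof. by move=> a u v; apply: val_inj; rewrite /= mulrDl -scalerAl. Qed.

HB.instance Definition _ := GRing.isLinear.Build K (V d) (V (d + e)) _ mul_form
  mul_form_linear.

Definition mulf : 'Hom(V d, V (d + e)) := linfun mul_form.

Lemma val_mulf v : val (mulf v) = val v * f.
Proof. by rewrite lfunE. Qed.

End MulForm.

Lemma hpart_genU1 I d e f (hf : f \is e.-homog) : is_ideal I -> graded I ->
  hpart (ideal_gen (I `|` [set f])) (d + e) =
    (hpart I (d + e) + mulf d hf @: fullv)%VS.
Proof.
move=> iI gI; have iJ : is_ideal (ideal_gen (I `|` [set f])) by exact: ideal_gen_ideal.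
apply/vspaceP => v; apply/idP/idP.
  move=> /(hpartP _ iJ)/(ideal_genU1 _ _ iI)[i Ii [a vE]].
  have vE' : val v = pihomog mdeg (d + e) i + pihomog mdeg d a * f.
    rewrite -{1}(pihomog_dE (dhomog_is_dhomog v)) vE raddfD /=.
    by rewrite pihomog_mulr.
  have -> : v = DHomog (pihomogP mdeg (d + e) i)
                + mulf d hf (DHomog (pihomogP mdeg d a)).
    by apply: val_inj; rewrite vE' /= val_mulf.
  apply: memv_add; first by apply/hpartP => //; apply: gI.
  by apply: memv_img; apply: memvf.
move=> /memv_addP[u /(hpartP _ iI) Iu [_ /memv_imgP[w _ ->] ->]].
apply/(hpartP _ iJ)/(ideal_genU1 _ _ iI); exists (val u) => //.
by exists (val w); rewrite /= val_mulf.
Qed.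

(** Multiplication by [f] gives an exact sequence [0 -> S/(I : f)(-e) -> S/I
    -> S/(I, f) -> 0]. The dimension count is valid for [f = 0] too, because
    the kernel of the multiplication is contained in [(I : f)]. *)
Lemma hilbert_colon I d e f : is_ideal I -> graded I -> f \is e.-homog ->
  (hilbert_fun (ideal_gen (I `|` [set f])) (d + e)
     + hilbert_fun (colon I f) d)%N = hilbert_fun I (d + e).
Proof.
move=> iI gI hf; have iC : is_ideal (colon I f) by exact: colon_ideal.
have iJ : is_ideal (ideal_gen (I `|` [set f])) by exact: ideal_gen_ideal.
have hI := hilbert_dim (d + e) iI; have hC := hilbert_dim d iC.
have hJ := hilbert_dim (d + e) iJ; rewrite hpart_genU1 // in hJ.
have cap_mulf : (hpart I (d + e) :&: mulf d hf @: fullv)%VS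
    = (mulf d hf @: hpart (colon I f) d)%VS.
  apply/vspaceP => v; rewrite memv_cap; apply/andP/idP.
    move=> [/(hpartP _ iI) Iv /memv_imgP[w _ vE]]; rewrite vE; apply: memv_img.
    by apply/hpartP => //; move: Iv; rewrite vE val_mulf.
  move=> /memv_imgP[w /(hpartP _ iC) Cw ->]; split; last exact/memv_img/memvf.
  by apply/hpartP => //; rewrite val_mulf.
have ker_sub : (fullv :&: lker (mulf d hf) = hpart (colon I f) d :&: lker (mulf d hf))%VS.
  apply/vspaceP => v; rewrite !memv_cap memvf /=; case: (boolP (v \in lker _)).
    rewrite memv_ker andbT => /eqP v0; apply/esym/(hpartP _ iC).
    by rewrite /colon /= -(val_mulf hf) v0; apply: ideal0.
  by rewrite andbF.
have := limg_ker_dim (mulf d hf) fullv; rewrite ker_sub.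
have := limg_ker_dim (mulf d hf) (hpart (colon I f) d).
have := dimv_sum_cap (hpart I (d + e)) (mulf d hf @: fullv); rewrite cap_mulf.
move: hI hC hJ.
move: (\dim (hpart I (d + e) + _)); move: (\dim (mulf d hf @: hpart _ _)).
move: (\dim (hpart I _)) => x; move: (\dim (limg _)) (\dim (_ :&: _)) => y z.
move: (\dim (hpart _ _)) => w; move: (\dim {:V d}) => u.
by move: (\dim {:V (d + e)}) => *; lia.
Qed.

End Hilbert.

(** * Hilbert functions of linear primes and of their intersections *)

Section LinearHilbert.
Variable K : fieldType.

Section SubstHomog.
Variables (m n d : nat) (M : 'M[K]_(m, n)).

Definition lsub_homog_fun (v : dhomog m K d) : dhomog n K d :=
  DHomog (lsub_homog M (dhomog_is_dhomog v)).

Lemma lsub_homog_linear : linear lsub_homog_fun.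
Proof. by move=> a u v; apply: val_inj; rewrite /= raddfD /= comp_mpolyZ. Qed.

HB.instance Definition _ := GRing.isLinear.Build K _ _ _ lsub_homog_fun
  lsub_homog_linear.

End SubstHomog.

(** A left inverse of [M] makes the substitution surjective, so the quotient
    is the polynomial ring in [k.+1] variables. *)
Lemma hilbert_lker_full n k (M : 'M[K]_(n.+1, k.+1)) d : row_full M ->
  hilbert_fun (lker_ideal M) d = 'C(d + k, k).
Proof.
move=> /row_fullP[D DM].
have iP : is_ideal (lker_ideal M) by apply/prime_ideal/lker_ideal_prime.
pose g : 'Hom(dhomog n.+1 K d, dhomog k.+1 K d) := linfun (lsub_homog_fun M).
have gE v : val (g v) = lsub M (val v) by rewrite lfunE.
have ker_g : lker g = hpart (lker_ideal M) d.
  apply/vspaceP => v; rewrite memv_ker; apply/eqP/idP => [v0|/(hpartP _ iP) Mv].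
    by apply/(hpartP _ iP); rewrite /lker_ideal /= -gE v0.
  by apply: val_inj; rewrite gE.
have im_g : limg g = fullv.
  apply/vspaceP => v; rewrite memvf; apply/memv_imgP.
  exists (lsub_homog_fun D v); first exact: memvf.
  by apply: val_inj; rewrite gE /= lsub_comp DM lsub1.
have := limg_ker_dim g fullv; rewrite capfv ker_g im_g dim_homog addnC => h.
by apply/eqP; rewrite -(eqn_add2r (\dim (hpart (lker_ideal M) d))) hilbert_dim // h.
Qed.

(** The matrix [cokermx A] is square; a column base keeps the kernel of the
    substitution and makes the matrix left invertible. *)
Lemma lker_ideal_col_base m n (M : 'M[K]_(m, n)) :
  lker_ideal (col_base M) = lker_ideal M.
Proof.
have /row_freeP[B MB] := row_base_free M; apply/seteqP; split.
  have := @lker_ideal_sub K _ _ _ (col_base M) (row_base M).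
  by rewrite mulmx_base.
have <- : M *m B = col_base M by rewrite -[X in X *m B](mulmx_base M) -mulmxA MB mulmx1.
exact: lker_ideal_sub.
Qed.

Lemma hilbert_linear n k (A : 'M[K]_n.+1) d : (\rank A + k = n)%N ->
  hilbert_fun (lker_ideal (cokermx A)) d = 'C(d + k, k).
Proof.
move=> rA; rewrite -lker_ideal_col_base.
have : row_full (col_base (cokermx A)) := col_base_full _.
have : \rank (cokermx A) = k.+1 by rewrite mxrank_coker; lia.
by move: (col_base _) => C rC; move: C; rewrite rC => C; apply: hilbert_lker_full.
Qed.

End LinearHilbert.

Section LinearPrimes.
Variables (K : fieldType) (s : nat).
Notation S := {mpoly K[s]}.
Implicit Types (P Q I : set S) (l : seq (set S)) (A B : 'M[K]_s).

(** The number [r] is the codimension. The row space of [A] consists of the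
    linear forms in [P]. *)
Definition linear_prime (r : nat) P : Prop :=
  exists2 A : 'M[K]_s, \rank A = r & P = lker_ideal (cokermx A).

Lemma lker_coker_lform A v : lker_ideal (cokermx A) (lform v) <-> (v <= A)%MS.
Proof. by rewrite submxE; split=> [/lker_ideal_lform ->|/eqP/lker_ideal_lform]. Qed.

Lemma linear_prime_prime r P : linear_prime r P -> is_prime_ideal P.
Proof. by move=> [A _ ->]; apply: lker_ideal_prime. Qed.

Lemma linear_prime_graded r P : linear_prime r P -> graded P.
Proof. by move=> [A _ ->]; apply: lker_ideal_graded. Qed.

Lemma linear_prime_form r P Q : linear_prime r P -> is_ideal Q -> ~ P `<=` Q ->
  exists v, P (lform v) /\ ~ Q (lform v).
Proof.
move=> [A _ ->] iQ nPQ; apply: contrapT => nv; apply: nPQ.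
rewrite {1}lker_ideal_gen; apply: ideal_gen_sub => // p [v vA ->].
apply: contrapT => Qv; apply: nv; exists v; split=> //.
exact/lker_ideal_lform.
Qed.

(** The linear forms in [P] and in [Q] span spaces of the same dimension, and
    these forms generate the ideals. *)
Lemma linear_prime_sub_eq r P Q :
  linear_prime r P -> linear_prime r Q -> P `<=` Q -> P = Q.
Proof.
move=> [A rA ->] [B rB ->] AB.
have le_AB : (A <= B)%MS.
  by apply/rV_subP => v /lker_coker_lform/AB/lker_coker_lform.
have le_BA : (B <= A)%MS.
  by rewrite -(geq_leqif (mxrank_leqif_sup le_AB)) rA rB.
apply/seteqP; split; first exact: AB.
rewrite lker_ideal_gen; apply: ideal_gen_sub; first exact/prime_ideal/lker_ideal_prime.
move=> p [v /lker_ideal_lform/lker_coker_lform vB ->].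
by apply/lker_coker_lform; apply: submx_trans le_BA.
Qed.

(** The form is a product of linear forms, one in each member of [l] and
    outside [P]. *)
Lemma cap_form r P l : is_prime_ideal P ->
    (forall Q, Q \in l -> linear_prime r Q /\ ~ Q `<=` P) ->
  exists D g, [/\ g \is D.-homog, cap l g & ~ P g].
Proof.
move=> pP; elim: l => [_|Q l IHl lP].
  exists 0%N, 1; split=> //; [exact: dhomog1 | exact: prime_proper].
have [Q' Q'l|D [g [hg lg Pg]]] := IHl; first by apply: lP; rewrite inE Q'l orbT.
have [linQ QP] := lP Q (mem_head _ _).
have [v [Qv Pv]] := linear_prime_form linQ (prime_ideal pP) QP.
exists (1 + D)%N, (lform v * g); split; last by move=> /(primeM pP)[].
  by apply: dhomogM => //; apply: lform_homog.
rewrite cap_cons; split.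
  by apply: idealMr => //; apply/prime_ideal/(linear_prime_prime linQ).
apply: (@idealM _ (cap l)) => //; apply: cap_ideal => Q' Q'l.
by have [|/linear_prime_prime/prime_ideal] := lP Q'; rewrite ?inE ?Q'l ?orbT.
Qed.

Lemma cap_graded l : (forall Q, Q \in l -> graded Q) -> graded (cap l).
Proof. by move=> gl p lp d Q Ql; apply: gl => //; apply: lp. Qed.

End LinearPrimes.

Section CapHilbert.
Variables (K : fieldType) (n : nat).
Notation S := {mpoly K[n.+1]}.
Implicit Types (P Q I : set S) (l : seq (set S)).

Lemma hilbert_setT d : hilbert_fun [set: S] d = 0%N.
Proof.
have iT : is_ideal [set: S] by [].
apply/eqP; rewrite -(eqn_add2r (\dim (hpart [set: S] d))) hilbert_dim // add0n.
by apply/eqP; congr (\dim _); apply/vspaceP => v; rewrite memvf; apply/esym/(hpartP _ iT).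
Qed.

Lemma hilbert_setI_le P Q d : is_ideal P -> is_ideal Q ->
  (hilbert_fun (P `&` Q) d <= hilbert_fun Q d + hilbert_fun P d)%N.
Proof.
move=> iP iQ; have := hilbert_dim d (idealI iP iQ); rewrite hpart_setI //.
have := hilbert_dim d iP; have := hilbert_dim d iQ.
have := dimv_sum_cap (hpart P d) (hpart Q d).
have : (\dim (hpart P d + hpart Q d) <= \dim {: dhomog n.+1 K d})%N.
  exact/dimvS/subvf.
move: (\dim (_ + _)) (\dim (_ :&: _)) => a b.
move: (\dim (hpart P _)) (\dim (hpart Q _)) (\dim {: _}) => c e f.
by move: (hilbert_fun Q d) (hilbert_fun P d) (hilbert_fun (P `&` Q) d) => *; lia.
Qed.

(** The Hilbert function of [P `&` Q] exceeds that of [Q] by the dimension of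
    the homogeneous part of [(P + Q) / P], which contains the multiples of
    [g]; as [g] is regular modulo [P], these account for a copy of [S / P]
    shifted by [D]. *)
Lemma hilbert_setI_ge P Q d D g : is_prime_ideal P -> graded P -> is_ideal Q ->
    g \is D.-homog -> Q g -> ~ P g ->
  (hilbert_fun Q (d + D) + hilbert_fun P d <= hilbert_fun (P `&` Q) (d + D))%N.
Proof.
move=> pP gP iQ hg Qg Pg; have iP := prime_ideal pP.
have colP : colon P g = P.
  apply/seteqP; split=> [h /(primeM pP)[]//|h Ph]; exact: idealMr.
have := hilbert_colon d iP gP hg; rewrite colP.
have := hilbert_dim (d + D) (ideal_gen_ideal (P `|` [set g])).
rewrite (hpart_genU1 _ hg) //.
have := hilbert_dim (d + D) (idealI iP iQ); rewrite hpart_setI //.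
have := hilbert_dim (d + D) iP; have := hilbert_dim (d + D) iQ.
have := dimv_sum_cap (hpart P (d + D)) (hpart Q (d + D)).
have : (\dim (hpart P (d + D) + limg (mulf d hg)) <=
        \dim (hpart P (d + D) + hpart Q (d + D)))%N.
  apply/dimvS/addvS => //; apply/subvP => _ /memv_imgP[v _ ->].
  by apply/hpartP => //; rewrite val_mulf; apply: idealM.
move: (\dim (_ + _)) (\dim (_ :&: _)) (\dim (_ + limg _)) => a b c.
move: (\dim (hpart P _)) (\dim (hpart Q _)) (\dim {: _}) => e f h.
move: (hilbert_fun Q _) (hilbert_fun P d) (hilbert_fun P _) => x y z.
by move: (hilbert_fun (ideal_gen _) _) (hilbert_fun (P `&` Q) _) => *; lia.
Qed.

(** Adding one prime [P] to the intersection adds, to leading order, the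
    Hilbert function of [S / P]: no more by subadditivity, and no less up to
    a shift by [hilbert_setI_ge], applied to a form in the other primes and
    not in [P]. *)
Lemma hilbert_cap_cvg r k l : (r + k = n)%N -> uniq l ->
    (forall P, P \in l -> linear_prime r P) ->
  rat_cvg (fun d => (hilbert_fun (cap l) d)%:R / d%:R ^+ k)
          ((size l)%:R / k`!%:R).
Proof.
move=> rk; elim: l => [_ _|P l IHl /= /andP[Pl ul] linl].
  rewrite mul0r; have -> : cap [::] = [set: S] by apply/seteqP; split.
  under eq_fun do rewrite hilbert_setT mul0r.
  exact: rat_cvg_cst.
have linP : linear_prime r P by apply: linl; apply: mem_head.
have {}linl Q : Q \in l -> linear_prime r Q.
  by move=> Ql; apply: linl; rewrite inE Ql orbT.
have iQ : is_ideal (cap l).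
  by apply: cap_ideal => Q /linl/linear_prime_prime/prime_ideal.
have pP := linear_prime_prime linP; have iP := prime_ideal pP.
have [Q Ql|D [g [hg lg Pg]]] := @cap_form _ _ r P l pP.
  split=> [|QP]; first exact: linl.
  by move: Pl; rewrite -(linear_prime_sub_eq (linl Q Ql) linP QP) Ql.
have HP d : hilbert_fun P d = 'C(d + k, k).
  by case: linP => A rA ->; apply: hilbert_linear; rewrite rA.
rewrite cap_cons; apply/(rat_cvg_shift D).
have IHD := proj2 (rat_cvg_shift D _ _) (IHl ul linl).
have limE : (size l).+1%:R / k`!%:R = (size l)%:R / k`!%:R + k`!%:R^-1 :> rat.
  by rewrite -addn1 natrD mulrDl mul1r.
have lowD := rat_cvgD IHD (@rat_cvg_bin k D).
have uppD := rat_cvgD IHD (proj2 (rat_cvg_shift D _ _) (@rat_cvg_bin k 0)).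
rewrite limE; apply: (rat_cvg_squeeze _ lowD uppD).
move=> d; rewrite addn0 -!mulrDl -!natrD -!HP.
apply/andP; split; apply: ler_wpM2r; rewrite ?invr_ge0 ?exprn_ge0 ?ler0n // ler_nat.
  exact: (hilbert_setI_ge d pP (linear_prime_graded linP) iQ hg lg Pg).
exact: hilbert_setI_le.
Qed.

End CapHilbert.

(** * Degrees *)

Section Degree.
Variables (K : fieldType) (s : nat).
Notation S := {mpoly K[s]}.
Implicit Types (P Q : set S) (l : seq (set S)) (f : S).

(** The number of components [V(P)] on which [f] is not identically zero: the
    Hamming weight of [f] when the components are points. *)
Definition weight l f : nat := count (fun P => ~~ `[< P f >]) l.

Lemma colon_cap l f : (forall P, P \in l -> is_prime_ideal P) ->
  colon (cap l) f = cap [seq P <- l | ~~ `[< P f >]].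
Proof.
move=> pl; apply/seteqP; split=> h.
  move=> lhf P; rewrite mem_filter => /andP[/asboolPn nPf Pl].
  by have [] := primeM (pl P Pl) (lhf P Pl).
move=> lh P Pl; have [Pf|nPf] := pselect (P f).
  by apply: idealM Pf; apply/prime_ideal/pl.
apply: idealMr; first exact/prime_ideal/pl.
by apply: lh; rewrite mem_filter Pl andbT; apply/asboolPn.
Qed.

Lemma cap_prime l Q : is_prime_ideal Q -> (forall P, P \in l -> is_prime_ideal P) ->
  cap l `<=` Q -> exists2 P, P \in l & P `<=` Q.
Proof. by move=> pQ pl; apply: prime_avoid_cap => // P /pl/prime_ideal. Qed.

(** A component contained in [V(f)] is still a component of [V(I, f)], and no
    larger subspace appears. *)
Lemma krull_dim_cap_genU1 r l f P : (forall P, P \in l -> linear_prime r P) ->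
  P \in l -> P f -> krull_dim_quot (ideal_gen (cap l `|` [set f])) = (s - r)%N.
Proof.
move=> linl Pl Pf; have pl Q : Q \in l -> is_prime_ideal Q.
  by move=> /linl/linear_prime_prime.
have [A rA PE] := linl P Pl; rewrite -rA; apply: krull_dim_linear.
  rewrite -PE; apply: ideal_gen_sub; first exact/prime_ideal/pl.
  by move=> g [lg|->//]; apply: lg.
move=> Q pQ JQ; have [|P' P'l P'Q] := @cap_prime l Q pQ pl.
  by move=> g lg; apply: JQ; apply: sub_ideal_gen; left.
by have [B rB P'E] := linl P' P'l; exists B; rewrite ?rA // -P'E.
Qed.

Lemma ideal_gen_set0 (I : set S) : is_ideal I -> ideal_gen (I `|` [set 0]) = I.
Proof.
move=> iI; apply/seteqP; split; last by move=> p Ip; apply: sub_ideal_gen; left.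
by apply: ideal_gen_sub => // p [//|->]; apply: ideal0.
Qed.

Lemma linear_cap_ideal r l : (forall P, P \in l -> linear_prime r P) ->
  is_ideal (cap l).
Proof. by move=> linl; apply: cap_ideal => P /linl/linear_prime_prime/prime_ideal. Qed.

End Degree.

(** By the exact sequence of [hilbert_colon], the leading coefficient of the
    Hilbert function is the difference of those of [I] and of [(I : f)],
    which are proportional to the number of all primes and to the number of
    primes that do not contain [f]. *)
Lemma degree_cap_genU1 (K : fieldType) n r k e (l : seq (set {mpoly K[n.+1]})) f P :
    (r + k = n)%N -> uniq l -> (forall P, P \in l -> linear_prime r P) ->
    f \is e.-homog -> P \in l -> P f ->
  degree (ideal_gen (cap l `|` [set f])) = (size l - weight l f)%N.
Proof.
move=> rk ul linl hf Pl Pf.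
have wl : (weight l f <= size l)%N by apply: count_size.
set J := ideal_gen _; pose c := (size l - weight l f)%N.
have fk : k`!%:R != 0 :> rat by rewrite pnatr_eq0 -lt0n fact_gt0.
have iI := linear_cap_ideal linl.
have gI : graded (cap l) by apply: cap_graded => Q /linl/linear_prime_graded.
have limJ : rat_cvg (fun d => (hilbert_fun J d)%:R / d%:R ^+ k) (c%:R / k`!%:R).
  have linC Q : Q \in [seq P <- l | ~~ `[< P f >]] -> linear_prime r Q.
    by rewrite mem_filter => /andP[_ /linl].
  apply/(rat_cvg_shift e).
  have := rat_cvgB (proj2 (rat_cvg_shift e _ _) (hilbert_cap_cvg rk ul linl))
    (rat_cvg_delay e (hilbert_cap_cvg rk (filter_uniq _ ul) linC)).
  rewrite size_filter -/(weight l f) -mulrBl -natrB //; congr rat_cvg.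
  apply/funext => d; rewrite -mulrBl; congr (_ / _).
  rewrite -(hilbert_colon d iI gI hf) colon_cap ?natrD ?addrK //.
  by move=> Q /linl/linear_prime_prime.
rewrite /degree (krull_dim_cap_genU1 linl Pl Pf).
have -> : (n.+1 - r)%N = k.+1 by lia.
rewrite /=; case: xgetP => [N _ [lim cvlim NE]|/(_ c)[]]; last first.
  by exists (c%:R / k`!%:R) => //; rewrite mulrC divfK.
apply/eqP; rewrite -(eqr_nat rat) NE.
by rewrite (rat_cvg_unique cvlim limJ) mulrC divfK.
Qed.

Lemma degree_cap (K : fieldType) n r k (l : seq (set {mpoly K[n.+1]})) :
    (r + k = n)%N -> uniq l -> (forall P, P \in l -> linear_prime r P) ->
  (0 < size l)%N -> degree (cap l) = size l.
Proof.
move=> rk ul linl l_gt0; have iI := linear_cap_ideal linl.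
have [P Pl] : exists P, P \in l.
  by case: l l_gt0 {ul linl iI} => // P t _; exists P; rewrite mem_head.
have l0 Q : Q \in l -> Q 0.
  by move=> Ql; apply: (ideal0 (prime_ideal (linear_prime_prime (linl Q Ql)))).
(* The formula for [(I, f)] with [f = 0], whose weight is zero. *)
rewrite -(ideal_gen_set0 iI).
rewrite (degree_cap_genU1 rk ul linl (dhomog0 _ mdeg 0) Pl (l0 P Pl)).
rewrite -[RHS]subn0; congr (_ - _)%N; apply/eqP; rewrite eqn0Ngt -has_count.
by apply/hasPn => Q Ql; rewrite negbK; apply/asboolP; apply: l0.
Qed.

Lemma cap1 (R : comNzRingType) (P : set R) : cap [:: P] = P.
Proof.
apply/seteqP; split=> [p lp|p Pp Q]; first by apply: lp; rewrite mem_head.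
by rewrite inE => /eqP->.
Qed.

Section PointDegree.
Variables (K : fieldType) (s : nat).
Notation S := {mpoly K[s]}.
Implicit Types (P Q : set S).

Lemma linear_prime_full P v : linear_prime s P -> P (lform v).
Proof.
move=> [A rA ->]; apply/lker_coker_lform; apply: submx_full.
by rewrite /row_full rA.
Qed.

Lemma linear_prime_full_unique P Q : linear_prime s P -> linear_prime s Q -> P = Q.
Proof.
move=> linP linQ; apply: (linear_prime_sub_eq linP linQ) => p Pp; apply: contrapT => nQp.
have [|v [_]] := linear_prime_form linP (prime_ideal (linear_prime_prime linQ)).
  by move=> PQ; apply: nQp; apply: PQ.
by apply; apply: linear_prime_full.
Qed.

(** A linear prime of codimension [s] is the ideal of the origin, and [c] is
    the value of [p] there. *)
Lemma linear_prime_full_const P p : linear_prime s P -> exists c, P (p - c%:MP).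
Proof.
move=> linP; have iP := prime_ideal (linear_prime_prime linP).
elim/mpoly_ind_ring: p => [c|i|p q [a Pa] [b Pb]|p q [a Pa] [b Pb]].
- by exists c; rewrite subrr; apply: ideal0.
- by exists 0; rewrite mpolyC0 subr0 -lform_delta; apply: linear_prime_full.
- by exists (a + b); rewrite mpolyCD opprD addrACA; apply: idealD.
exists (a * b); rewrite mpolyCM.
have -> : p * q - a%:MP * b%:MP = q * (p - a%:MP) + a%:MP * (q - b%:MP).
  by rewrite !mulrBr (mulrC q p) (mulrC q) addrA subrK.
by apply: idealD => //; apply: idealM.
Qed.

(** In dimension zero the degree is the dimension of [S / P], and this
    quotient is [K]. *)
Lemma degree_full P : linear_prime s P -> degree P = 1%N.
Proof.
move=> linP; have pP := linear_prime_prime linP; have iP := prime_ideal pP.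
have dimP : krull_dim_quot P = 0%N.
  have := @krull_dim_cap_genU1 _ _ s [:: P] 0 P.
  rewrite cap1 ideal_gen_set0 // subnn; apply; rewrite ?mem_head //; last exact: ideal0.
  by move=> Q; rewrite inE => /eqP->.
rewrite /degree dimP /=; apply: set_maxE => [|m [b _ bfree]].
  exists (fun=> 1) => // c; rewrite big_ord1 => Pc i; rewrite ord1.
  apply: contrapT => /eqP nzc; apply: (prime_proper pP).
  by rewrite -(scalerK nzc 1) -mul_mpolyC; apply: idealM.
case: m b bfree => [//|[//|m]] b bfree; exfalso.
have [c Pc] := choice (fun i => linear_prime_full_const (b i) linP).
pose i0 : 'I_m.+2 := ord0; pose i1 : 'I_m.+2 := lift ord0 ord0.
have indep a a' : P (a *: b i0 + a' *: b i1) -> a = 0 /\ a' = 0.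
  pose u i := if i == i0 then a else if i == i1 then a' else 0.
  move=> Pa; have /bfree u0 : P (\sum_i u i *: b i).
    rewrite (bigD1 i0) // (bigD1 i1) //= big1 ?addr0 // => i /andP[/negPf i_i0 /negPf i_i1].
    by rewrite /u i_i0 i_i1 scale0r.
  by have := u0 i0; have := u0 i1; rewrite /u /=.
(* Any two elements are proportional modulo [P]. *)
have [] := indep (c i1) (- c i0).
  have -> : c i1 *: b i0 + - c i0 *: b i1 =
      (c i1)%:MP * (b i0 - (c i0)%:MP) - (c i0)%:MP * (b i1 - (c i1)%:MP).
    by rewrite scaleNr -!mul_mpolyC; ring.
  by apply: idealB => //; apply: idealM.
move=> _ /eqP; rewrite oppr_eq0 => /eqP c0.
have [|/eqP] := indep 1 0; last by rewrite oner_eq0.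
by rewrite scale1r scale0r addr0 -[b i0]subr0 -mpolyC0 -c0.
Qed.

Lemma linear_prime_le r P : linear_prime r P -> (r <= s)%N.
Proof. by move=> [A <- _]; apply: rank_leq_row. Qed.

(** In codimension [s] there is only one linear prime, the ideal of the
    origin. *)
Lemma linear_primes_codim r (l : seq (set S)) : uniq l ->
  (forall P, P \in l -> linear_prime r P) -> (1 < size l)%N -> (r < s)%N.
Proof.
case: l => [//|P [//|Q t]] /= /andP[PQt _] linl _.
have linP : linear_prime r P by apply: linl; rewrite mem_head.
have linQ : linear_prime r Q by apply: linl; rewrite !inE eqxx orbT.
rewrite ltn_neqAle (linear_prime_le linP) andbT; apply/eqP => rs.
subst r.
by move: PQt; rewrite (linear_prime_full_unique linP linQ) mem_head.
Qed.

End PointDegree.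

Lemma degree_linear_prime (K : fieldType) s r (P : set {mpoly K[s]}) :
  linear_prime r P -> degree P = 1%N.
Proof.
move=> linP; have := linear_prime_le linP.
rewrite leq_eqVlt => /predU1P[rs|]; first by subst r; apply: degree_full.
case: s P linP => // n P linP; rewrite ltnS => /subnKC rk.
rewrite -[P]cap1 (degree_cap rk) // => Q; by rewrite inE => /eqP->.
Qed.

(** * The minimum distance *)

Lemma sub_in_count (T : eqType) (a b : pred T) (t : seq T) :
  {in t, forall x, a x -> b x} -> (count a t <= count b t)%N.
Proof.
move=> ab; rewrite (@eq_in_count _ a (predI a b)) => [|x xt] /=.
  by apply: sub_count => x /andP[].
by case: (boolP (a x)) => // ax; rewrite (ab x xt ax).
Qed.

Lemma set_max_attained (A : set nat) N :
    A !=set0 -> (forall m, A m -> (m <= N)%N) ->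
  A (set_max A) /\ forall m, A m -> (m <= set_max A)%N.
Proof.
move=> [a Aa] ubN.
have ex : exists m, `[< A m >] by exists a; apply/asboolP.
have ub m : `[< A m >] -> (m <= N)%N by move=> /asboolP/ubN.
case: (ex_maxnP ex ub) => M /asboolP AM maxM.
have -> : set_max A = M by apply: set_maxE => // m Am; apply: maxM; apply/asboolP.
by split=> // m Am; apply: maxM; apply/asboolP.
Qed.

Section MinDist.
Variables (K : fieldType) (s r : nat).
Notation S := {mpoly K[s]}.
Implicit Types (P Q : set S) (f : S).
Variable l : seq (set S).
Hypotheses (ul : uniq l) (linl : forall P, P \in l -> linear_prime r P).

Lemma component_prime P : P \in l -> is_prime_ideal P.
Proof. by move=> /linl/linear_prime_prime. Qed.

Lemma distinct_form P Q : P \in l -> Q \in l -> P != Q ->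
  exists v, P (lform v) /\ ~ Q (lform v).
Proof.
move=> Pl Ql PQ; apply: (linear_prime_form (linl Pl)).
  exact/prime_ideal/component_prime.
move=> /(linear_prime_sub_eq (linl Pl) (linl Ql)) PQ'.
by move: PQ; rewrite PQ' eqxx.
Qed.

Lemma weight_gt0 f : (0 < weight l f)%N <-> ~ cap l f.
Proof.
rewrite -has_count; split=> [/hasP[P Pl /asboolPn nPf] lf|nlf].
  by apply: nPf; apply: lf.
apply: contrapT => /negP/hasPn nf; apply: nlf => P /nf.
by rewrite negbK => /asboolP.
Qed.

Lemma weight_le f : (weight l f <= size l)%N.
Proof. exact: count_size. Qed.

Lemma weight_max f : (weight l f < size l)%N <-> exists2 P, P \in l & P f.
Proof.
rewrite ltn_neqAle weight_le andbT -all_count -has_predC; split.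
  by move=> /hasP[P Pl] /=; rewrite negbK => /asboolP; exists P.
by move=> [P Pl Pf]; apply/hasP; exists P; rewrite //= negbK; apply/asboolP.
Qed.

(** If [f] is in no component, [(I : f)] is the intersection of all of them.
    If [f] is in [P], a form that is in all components but [P] belongs to [(I
    : f)] and not to [I]. *)
Lemma zero_div_formsP d f : zero_div_forms (cap l) d f <->
  f \is d.-homog /\ (0 < weight l f < size l)%N.
Proof.
split=> [[hf nlf colf]|[hf /andP[/weight_gt0 nlf /weight_max[P Pl Pf]]]].
  split=> //; apply/andP; split; first exact/weight_gt0.
  apply/weight_max; apply: contrapT => nf; apply: colf.
  rewrite colon_cap; last exact: component_prime.
  rewrite (_ : filter _ _ = l) //; apply/all_filterP/allP => P Pl.
  by apply/asboolPn => Pf; apply: nf; exists P.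
split=> // colf.
have [Q|D [g [_ lg Pg]]] := @cap_form _ _ r P (rem P l) (component_prime Pl).
  rewrite (mem_rem_uniq _ ul) => /andP[/= QP Ql]; split; first exact: linl.
  move=> /(linear_prime_sub_eq (linl Ql) (linl Pl)) QP'.
  by move: QP; rewrite QP' eqxx.
apply: Pg; suff : cap l g by apply.
rewrite -colf => Q Ql; have [->|QP] := eqVneq Q P.
  by apply: idealM => //; apply/prime_ideal/component_prime.
apply: idealMr; first exact/prime_ideal/component_prime.
by apply: lg; rewrite (mem_rem_uniq _ ul) inE QP.
Qed.

(** Let [P] and [Q] be two components that do not contain [f]. A linear form
    in [P] and not in [Q] multiplies [f] into [P], and keeps it outside [Q]. *)
Lemma weight_drop d f : f \is d.-homog -> (1 < weight l f)%N ->
  exists2 g, g \is d.+1.-homog & (0 < weight l g < weight l f)%N.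
Proof.
move=> hf; rewrite /weight -size_filter.
have : uniq [seq P <- l | ~~ `[< P f >]] by rewrite filter_uniq.
have : {subset [seq P <- l | ~~ `[< P f >]] <= l} by apply: mem_subseq; apply: filter_subseq.
have allf : all (fun P => ~~ `[< P f >]) [seq P <- l | ~~ `[< P f >]] by apply: filter_all.
case E: [seq P <- l | ~~ `[< P f >]] allf => [//|P [//|Q t]] /= /and3P[nPf nQf _].
move=> subl /andP[]; rewrite inE negb_or => /andP[PQ _] _ _.
have Pl : P \in l by apply: subl; rewrite mem_head.
have Ql : Q \in l by apply: subl; rewrite !inE eqxx orbT.
have [v [Pv nQv]] := distinct_form Pl Ql PQ.
exists (f * lform v); first by rewrite -addn1; apply: dhomogM => //; apply: lform_homog.
apply/andP; split.
  apply/weight_gt0 => /(_ Q Ql)/(primeM (component_prime Ql))[|//].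
  by move/asboolPn: nQf.
have -> : (size t).+2 = weight l f by rewrite /weight -size_filter E.
(* The component [P] is counted in the weight of [f] only. *)
have <- : (count_mem P l + weight l (f * lform v) = (weight l (f * lform v)).+1)%N.
  by rewrite count_uniq_mem // Pl.
rewrite -count_predUI.
have -> : count (predI (pred1 P) (fun R => ~~ `[< R (f * lform v) >])) l = 0%N.
  apply/eqP; rewrite eqn0Ngt -has_count; apply/hasPn => R Rl /=.
  apply/negP => /andP[/eqP-> /asboolPn]; apply.
  by apply: idealM => //; apply/prime_ideal/component_prime.
rewrite addn0; apply: sub_in_count => R Rl /= /orP[/eqP->//|/asboolPn nR].
apply/asboolPn => Rf; apply: nR; apply: idealMr => //.
exact/prime_ideal/component_prime.
Qed.

(** The multiplier is a linear form outside the only component that does not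
    contain [f]; such a form exists because another component is not
    contained in it. *)
Lemma weight_one d f : (1 < size l)%N -> f \is d.-homog -> weight l f = 1%N ->
  exists2 g, g \is d.+1.-homog & weight l g = 1%N.
Proof.
move=> l1 hf wf; have : has (fun P => ~~ `[< P f >]) l by rewrite has_count -/(weight l f) wf.
move=> /hasP[P Pl /asboolPn nPf].
have [Q Ql QP] : exists2 Q, Q \in l & Q != P.
  apply: contrapT => nQ; move: l1; rewrite ltnNge => /negP; apply.
  rewrite -[X in (_ <= X)%N]/(size [:: P]); apply: uniq_leq_size => // Q Ql.
  by rewrite inE; apply/eqP; apply: contrapT => /eqP QP; apply: nQ; exists Q.
have [v [_ nPv]] := distinct_form Ql Pl QP.
exists (f * lform v); first by rewrite -addn1; apply: dhomogM => //; apply: lform_homog.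
apply/eqP; rewrite eqn_leq; apply/andP; split.
  rewrite -[X in (_ <= X)%N]wf; apply: sub_in_count => R Rl /= /asboolPn nR.
  apply/asboolPn => Rf; apply: nR; apply: idealMr => //.
  exact/prime_ideal/component_prime.
by apply/weight_gt0 => /(_ P Pl)/(primeM (component_prime Pl))[].
Qed.

Lemma exists_form d : (1 < size l)%N -> exists2 f, f \is d.-homog & (0 < weight l f)%N.
Proof.
case: l ul component_prime distinct_form => [//|P [//|Q t]] ul' pl dis _.
have Pl : P \in [:: P, Q & t] by rewrite mem_head.
have Ql : Q \in [:: P, Q & t] by rewrite !inE eqxx orbT.
have [|v [_ nQv]] := dis P Q Pl Ql.
  by move: ul'; rewrite /= inE negb_or => /andP[/andP[]].
exists (lform v ^+ d).
  by have := dhomogMn d (lform_homog v); rewrite mul1n.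
rewrite /weight -has_count; apply/hasP; exists Q => //; apply/asboolPn.
by move=> /(prime_exp (pl Q Ql)).
Qed.

End MinDist.

(** The forms outside [I] that are not in [zero_div_forms] are contained in
    no component: they have the largest weight [size l], which is also the
    value of the minimum distance when there are no zero divisors. *)
Lemma min_dist_weight (K : fieldType) n r k (l : seq (set {mpoly K[n.+1]})) d :
    (r + k = n)%N -> uniq l -> (forall P, P \in l -> linear_prime r P) ->
    (1 < size l)%N ->
  exists w : nat, [/\ min_dist (cap l) d = w%:Z,
    exists2 f, f \is d.-homog & (0 < weight l f)%N /\ weight l f = w &
    forall f, f \is d.-homog -> (0 < weight l f)%N -> (w <= weight l f)%N].
Proof.
move=> rk ul linl l1; have iI := linear_cap_ideal linl.
have degE f : zero_div_forms (cap l) d f ->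
    degree (ideal_gen (cap l `|` [set f])) = (size l - weight l f)%N.
  move=> /(zero_div_formsP ul linl)[hf /andP[_ /weight_max[P Pl Pf]]].
  exact: (degree_cap_genU1 rk ul linl hf Pl Pf).
have degI : degree (cap l) = size l by apply: (degree_cap rk) => //; apply: ltnW.
have full f : ~ zero_div_forms (cap l) d f -> f \is d.-homog ->
    (0 < weight l f)%N -> weight l f = size l.
  move=> nFf hf wf; apply/eqP; rewrite eqn_leq weight_le leqNgt; apply/negP => wl.
  by apply: nFf; apply/(zero_div_formsP ul linl); rewrite wf.
rewrite /min_dist; case: (eqVneq (zero_div_forms (cap l) d) set0) => [F0|/set0P[f0 Ff0]].
  exists (size l); rewrite degI; split=> //.
    have [f hf wf] := exists_form ul linl d l1.
    by exists f => //; split=> //; apply: full => //; rewrite F0.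
  by move=> f hf wf; rewrite (full f) //; rewrite F0.
set D := [set _ | _ in _].
have [||[f Ff DE] maxD] := @set_max_attained D (size l).
- by exists (degree (ideal_gen (cap l `|` [set f0]))), f0.
- by move=> _ [f /degE -> <-]; apply: leq_subr.
have [hf /andP[wf _]] := (zero_div_formsP ul linl d f).1 Ff.
exists (weight l f); split.
- rewrite degI -DE degE // -subzn ?weight_le //.
  by rewrite opprB addrCA subrr addr0.
- by exists f.
move=> g hg wg; have [/= Fg|/full ->] := pselect (zero_div_forms (cap l) d g);
  rewrite ?weight_le //.
have : D (size l - weight l g)%N by exists g => //; apply: degE.
move=> /maxD; rewrite -DE degE // => h.
by have := weight_le l f; have := weight_le l g; lia.
Qed.

Lemma min_dist_eventually1 (K : fieldType) n r k (l : seq (set {mpoly K[n.+1]})) :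
    (r + k = n)%N -> uniq l -> (forall P, P \in l -> linear_prime r P) ->
    (1 < size l)%N ->
  exists r0 : nat,
    [/\ (1 <= r0)%N,
        forall d, (1 <= d)%N -> (d < r0)%N ->
          min_dist (cap l) d.+1 < min_dist (cap l) d &
        forall d, (r0 <= d)%N -> min_dist (cap l) d = 1].
Proof.
move=> rk ul linl l1.
have [w wP] := choice (fun d => min_dist_weight d rk ul linl l1).
have distE d : min_dist (cap l) d = (w d)%:Z by case: (wP d).
have w_gt0 d : (0 < w d)%N by case: (wP d) => _ [f _ [wf <-]].
have w_drop d : (1 < w d)%N -> (w d.+1 < w d)%N.
  have [_ [f hf [_ <-]] _] := wP d; have [_ _ minw] := wP d.+1.
  move=> /(weight_drop ul linl hf)[g hg /andP[g0]].
  by apply: leq_ltn_trans; apply: minw.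
have w_stays d : w d = 1%N -> w d.+1 = 1%N.
  have [_ [f hf [_ <-]] _] := wP d; have [_ _ minw] := wP d.+1.
  move=> /(weight_one ul linl l1 hf)[g hg wg].
  by apply/eqP; rewrite eqn_leq w_gt0 -wg minw ?wg.
have ex1 : exists d, (0 < d)%N && (w d == 1)%N.
  apply: contrapT => no1.
  have w_gt1 d : (1 < w d.+1)%N.
    rewrite ltn_neqAle w_gt0 andbT eq_sym; apply/negP => w1.
    by apply: no1; exists d.+1; rewrite /= w1.
  have slope j : (w j.+1 + j <= w 1)%N.
    elim: j => [|j IHj]; first by rewrite addn0.
    by apply: leq_trans IHj; rewrite addnS ltn_add2r w_drop.
  by have := slope (w 1%N); have := w_gt1 (w 1%N); lia.
case: (ex_minnP ex1) => r0 /andP[r0_gt0 /eqP wr0] minr0.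
exists r0; split=> // [d d_gt0 d_r0|].
  rewrite !distE ltz_nat w_drop // ltn_neqAle w_gt0 andbT eq_sym; apply/negP => wd1.
  by move: d_r0; rewrite ltnNge minr0 // d_gt0.
suff w1 j : w (r0 + j)%N = 1%N.
  by move=> d /subnKC <-; rewrite distE w1.
by elim: j => [|j IHj]; rewrite ?addn0 // addnS w_stays.
Qed.

(** For a single component every form outside the ideal is regular, and the
    minimum distance is the degree of a linear subspace. *)
Lemma min_dist1 (K : fieldType) s r (P : set {mpoly K[s]}) d :
  linear_prime r P -> min_dist (cap [:: P]) d = 1.
Proof.
move=> linP; have linl Q : Q \in [:: P] -> linear_prime r Q by rewrite inE => /eqP->.
rewrite /min_dist (_ : zero_div_forms _ d = set0).
  by rewrite eqxx cap1 (degree_linear_prime linP).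
apply/seteqP; split=> // f /(@zero_div_formsP _ _ _ [:: P] isT linl)[_].
by case: (weight _ _) => [|[]].
Qed.

Theorem theorem3p8 (K : fieldType) (s : nat) (I : set {mpoly K[s]})
    (properI : is_proper_ideal I) (gradedI : graded I) (nzI : I <> [set 0])
    (unmixedI : unmixed I) (radicalI : radical I = I)
    (linearI : forall P, assoc_prime I P ->
       exists2 L : set {mpoly K[s]}, L `<=` homog_part 1 & P = ideal_gen L) :
  exists r0 : nat,
    [/\ (1 <= r0)%N,
        forall d, (1 <= d)%N -> (d < r0)%N -> min_dist I d.+1 < min_dist I d &
        forall d, (r0 <= d)%N ->
          min_dist I r0 = min_dist I d /\ min_dist I d = 1].
Proof.
have [iI nI1] := (is_proper_idealP I).1 properI.
have lker P : assoc_prime I P -> exists A : 'M[K]_s, P = lker_ideal (cokermx A).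
  by move=> /linearI[L]; apply: linear_prime_lker.
have [P0 aP0 _] := exists_assoc_avoiding (@mpoly_noetherian K s) iI radicalI nI1.
pose r := height P0.
have linI P : assoc_prime I P -> linear_prime r P.
  move=> aP; have [A PE] := lker P aP; exists A => //.
  by rewrite -height_lker -PE; apply: unmixedI.
have [l [ul lP IE]] := radical_is_cap (@mpoly_noetherian K s) iI radicalI
  (fun P Q aP aQ => linear_prime_sub_eq (linI P aP) (linI Q aQ)).
have linl P : P \in l -> linear_prime r P by move=> /lP/linI.
have l_gt0 : (0 < size l)%N.
  by case: l lP {ul IE linl} => // /(_ P0)[_ /(_ aP0)].
suff [r0 [r0_gt0 dec one]] : exists r0 : nat,
    [/\ (1 <= r0)%N,
        forall d, (1 <= d)%N -> (d < r0)%N -> min_dist I d.+1 < min_dist I d &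
        forall d, (r0 <= d)%N -> min_dist I d = 1].
  by exists r0; split=> // d r0d; rewrite !one.
rewrite IE; clearbody r; clear -ul linl l_gt0.
have [l1|l1] := leqP (size l) 1.
  have [P lE] : exists P, l = [:: P].
    by case: l l_gt0 l1 {ul linl} => [//|P []// _ _]; exists P.
  have linP : linear_prime r P by apply: linl; rewrite lE mem_head.
  exists 1%N; rewrite lE; split=> // [d d1|d _]; last exact: min_dist1 linP.
  by rewrite ltnNge d1.
have lt_rs : (r < s)%N by apply: (linear_primes_codim ul linl l1).
case: s l ul linl l_gt0 l1 lt_rs => // n l ul linl l_gt0 l1; rewrite ltnS => /subnKC rk.
exact: (min_dist_eventually1 rk ul linl l1).
Qed.
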